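(* We have \begin{align*} r_3(n) &\ge (\alpha(n)/2-O(1))^{n} \qquad \text{and} \\ r_{2t+3}(n) \ge r_{2t+2}(n) &\ge 2^{n \cdot ((1/t!)\alpha(n)^t - O(\alpha(n)^{t-1}) )} \qquad \text{for every fixed integer } t \geq 1. \end{align*}
   Context: Write $[n]=\{1,\dots,n\}$. An $n$-permutation is a permutation of $[n]$. For $1\le a_1<a_2<\dots<a_k\le n$, the restriction of an $n$-permutation $\pi$ to the $k$-tuple of positions $(a_1,\dots,a_k)$ is the $k$-permutation $\pi'$ satisfying $\pi'(i)<\pi'(j)\Leftrightarrow \pi(a_i)<\pi(a_j)$ for all $i,j$. A $k$-tuple of positions is shattered by a set $\mathcal P$ of $n$-permutations if each $k$-permutation appears as the restriction of some $\pi\in\mathcal P$ to that $k$-tuple. The VC-dimension of $\mathcal P$ is the size of the largest set of positions shattered by $\mathcal P$. $r_k(n)$ denotes the size of the largest set of $n$-permutations with VC-dimension $k$. Inverse Ackermann function: $\alpha_1(m)=\lceil m/2\rceil$; $\alpha_d(1)=0$ for $d\ge 2$; $\alpha_d(m)=1+\alpha_d(\alpha_{d-1}(m))$ for $m,d\ge 2$; and $\alpha(m)=\min\{k\ge 1:\alpha_k(m)\le 3\}$. Asymptotic notation is for $n\to\infty$ (so the bounds are for all sufficiently large $n$), with implied constants depending only on $t$ where $t$ occurs. *)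

(* Defs.v *)
From mathcomp Require Import all_boot all_fingroup.
From mathcomp Require Import zify.

Set Implicit Arguments.
Unset Strict Implicit.
Unset Printing Implicit Defensive.

(* Positions and values range over {0, ..., n-1} instead of {1, ..., n}. *)

Section Shattering.
Local Open Scope nat_scope.

Definition is_position_tuple (n k : nat) (a : k.-tuple 'I_n) : bool :=
  sorted (fun i j : 'I_n => i < j) a.

Definition is_restriction (n k : nat) (pi : 'S_n) (a : k.-tuple 'I_n)
    (pi' : 'S_k) : bool :=
  [forall i : 'I_k, forall j : 'I_k,
     (pi' i < pi' j) == (pi (tnth a i) < pi (tnth a j))].

Definition shattered (n k : nat) (P : {set 'S_n}) (a : k.-tuple 'I_n) : bool :=
  [forall pi' : 'S_k, exists pi in P, is_restriction pi a pi'].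

(* The empty set of permutations shatters nothing, not even the empty tuple;
   its VC-dimension is 0 by convention. *)
Definition VCdim (n : nat) (P : {set 'S_n}) : nat :=
  \max_(k < n.+1 |
    [exists a : k.-tuple 'I_n, is_position_tuple a && shattered P a]) k.

(* This is 0 when no set of n-permutations has VC-dimension k (e.g. n < k). *)
Definition r (k n : nat) : nat :=
  \max_(P : {set 'S_n} | VCdim P == k) #|P|.

End Shattering.

Section InverseAckermann.
Local Open Scope nat_scope.

(* Number of applications of f needed to bring m down to at most 1, cut off
   after `fuel` applications. *)
Fixpoint iter_count (f : nat -> nat) (fuel m : nat) : nat :=
  if fuel is fuel'.+1 then
    if m <= 1 then 0 else (iter_count f fuel' (f m)).+1
  else 0.

(* The recursion in m is not structural, whence the fuel m, which is always
   sufficient: alphad_1, alphad_d1 and alphad_rec below are the defining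
   equations.  The values at d = 0 or m = 0 are junk. *)
Fixpoint alphad (d m : nat) : nat :=
  match d with
  | 0 => 0
  | 1 => uphalf m
  | d'.+1 => iter_count (alphad d') m m
  end.

Lemma alphad_1 m : alphad 1 m = uphalf m.
Proof. by []. Qed.

Lemma alphad_d1 d : 2 <= d -> alphad d 1 = 0.
Proof. by case: d => [|[|d]]. Qed.

Lemma iter_count_fuel (f : nat -> nat) (f_lt : forall m, 2 <= m -> f m < m)
    p q m : m <= p -> m <= q -> iter_count f p m = iter_count f q m.
Proof.
elim: p q m => [|p IH] [|q] m //=.
- by rewrite leqn0 => /eqP ->.
- by move=> _; rewrite leqn0 => /eqP ->.
move=> mp mq; case: leqP => // m2; congr _.+1.
by apply: IH; have := f_lt _ m2; lia.
Qed.

Lemma iter_count_half (f : nat -> nat) (f_half : forall m, f m <= uphalf m)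
    p m : iter_count f p m <= uphalf m.
Proof.
elim: p m => [|p IH] m //=; case: (leqP m 1) => // m2; have fm := f_half m.
have [m_le2|m_gt2] := leqP m 2; last by have := IH (f m); lia.
have fm1 : f m <= 1 by lia.
by case: p {IH} => [|p] /=; rewrite ?fm1; lia.
Qed.

Lemma alphad_half d m : alphad d m <= uphalf m.
Proof.
elim: d m => [|[|d] IH] m //=.
exact: iter_count_half.
Qed.

Lemma alphad_rec d m : 2 <= d -> 2 <= m ->
  alphad d m = (alphad d (alphad d.-1 m)).+1.
Proof.
case: d => [|[|d]] // _; case: m => [|[|m]] // _.
have lt_a k : 2 <= k -> alphad d.+1 k < k.
  by move=> k2; have := alphad_half d.+1 k; lia.
set x := alphad d.+1 m.+2.
suff -> : alphad d.+2 x = iter_count (alphad d.+1) m.+1 x by [].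
apply: (iter_count_fuel lt_a) => //.
by rewrite /x; have := lt_a m.+2 isT; lia.
Qed.

Lemma alpha_exists m : exists k, (1 <= k) && (alphad k m <= 3).
Proof.
suff H d : 1 <= d -> forall x, alphad d m <= x ->
    exists k, (1 <= k) && (alphad k m <= 3).
  exact: (H 1 isT _ (leqnn _)).
move=> d1 x; elim: x d d1 => [|x IH] d d1 le_x.
  by exists d; rewrite d1; lia.
have [le3|gt3] := leqP (alphad d m) 3; first by exists d; rewrite d1.
apply: (IH d.+1) => //.
have m2 : 2 <= m by have := alphad_half d m; lia.
rewrite alphad_rec //=; have := alphad_half d.+1 (alphad d m).
by rewrite -/(alphad d.+1 _); lia.
Qed.

Definition alpha (m : nat) : nat := ex_minn (alpha_exists m).

End InverseAckermann.

(* Main.v *)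
Require Import Defs.
From HB Require Import structures.
From mathcomp Require Import all_boot all_fingroup.
From mathcomp Require Import zify.

(** Call a word over [n] of order s if the restriction of the word to any two
    symbols has at most s + 1 runs (a Davenport-Schinzel word of order s, up to
    repetitions).  If all orderings of k symbols are subsequences of a word, then
    some two of these symbols have k + 1 runs; hence the permutations whose
    listing is a subsequence of a word of order s have VC-dimension at most s.
    If each symbol occurs mu times and the word is cut into M blocks of distinct
    symbols, there are at least mu^n / C(n + M, M) such permutations.  Adding one
    permutation raises the VC-dimension by at most 1, so the set can be enlarged
    to one of VC-dimension exactly s.

    Words of order 2t+2 with mu = 2^C(k,t), and of order 3 with mu = k + 1, come
    from a double recursion on k and on the length m of the special blocks, in
    the style of Agarwal-Sharir-Shor and Nivasch: each special block of a word of
    level k - 1 is expanded (by a word of order 2 less, resp. by writing it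
    twice), then each resulting special block is distributed over the special
    blocks of a fresh copy of the word of parameters (k, m - 1).  The number of
    blocks is of Ackermann type in k, so that k = alpha(n) - 7 is affordable. *)

Set Implicit Arguments.
Unset Strict Implicit.
Unset Printing Implicit Defensive.

(** * Runs of a two-letter restriction *)

Fixpoint runs (s : seq bool) : nat :=
  if s is x :: s' then (ohead s' != Some x) + runs s' else 0.

(** Only the first letter of the suffix affects the runs counted to its left; the additive form
    avoids truncated subtraction. *)
Lemma runs_cat_ohead p r r' : ohead r = ohead r' ->
  runs (p ++ r) + runs r' = runs (p ++ r') + runs r.
Proof.
move=> h; elim: p => [|x p IH] /=; first by rewrite addnC.
suff -> : ohead (p ++ r) = ohead (p ++ r') by lia.
by case: p {IH}.
Qed.

Lemma runs_cat u v : runs (u ++ v) <= runs u + runs v.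
Proof.
elim: u => [|x [|y u] IH] //=; last by rewrite -addnA leq_add2l.
by case: (_ != _).
Qed.

Lemma runs_size u : runs u <= size u.
Proof. by elim: u => //= x u IH; case: (_ != _); lia. Qed.

Lemma runs_negb u : runs (map negb u) = runs u.
Proof. by elim: u => //= x u ->; case: u => //= y u; case: x; case: y. Qed.

Lemma odd_runs x r : odd (runs (x :: r)) = (last x r == x).
Proof.
elim: r x => [|y r IH] x; first by case: x.
have -> : runs [:: x, y & r] = (Some y != Some x) + runs (y :: r) by [].
by rewrite oddD IH /=; case: x; case: y; case: (last _ r).
Qed.

Lemma subseq2_cat (T : eqType) (x y : T) u v :
  subseq [:: x; y] (u ++ v) =
  [|| subseq [:: x; y] u, subseq [:: x; y] v | (x \in u) && (y \in v)].
Proof.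
elim: u => [|z u IH] /=; first by rewrite orbF.
rewrite in_cons; have [->|xz] := eqVneq x z; last by rewrite IH.
rewrite !sub1seq mem_cat /=; case: (y \in u) => //=.
case vy: (y \in v); rewrite ?orbT // !orbF.
by apply/esym/negP => /mem_subseq/(_ y); rewrite !inE eqxx orbT vy => /(_ isT).
Qed.

Lemma subseq2_mem (T : eqType) (x y : T) u :
  subseq [:: x; y] u -> (x \in u) /\ (y \in u).
Proof. by move=> /mem_subseq h; split; apply: h; rewrite !inE eqxx ?orbT. Qed.

(** [u] consists of trues followed by falses. Its run of trues is paid by the first correction term,
    its run of falses by the second, which vanishes when that run merges into [r]. *)
Lemma runs_falling u r : ~~ subseq [:: false; true] u ->
  runs (u ++ r) <=
    runs r + (ohead (u ++ r) == Some true) + (ohead r != Some false).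
Proof.
elim: u => [_|x u IH] /=; first by rewrite -addnA leq_addr.
case: x => /=; last first.
  rewrite sub1seq => tu.
  have {tu IH} uE : u = nseq (size u) false.
    by apply/all_pred1P/allP => -[] //; rewrite (negbTE tu).
  rewrite uE; elim: (size u) => [|n IHn] /=; last by rewrite -addnA; lia.
  by rewrite addn0 addnC.
move=> /IH {IH}; case: (ohead (u ++ r)) => [[]|] //=; lia.
Qed.

Lemma runs_rising v : ~~ subseq [:: true; false] v -> runs (false :: v) <= 2.
Proof.
move=> nv; have := @runs_falling (map negb v) [::].
rewrite cats0 runs_negb.
have -> : subseq [:: false; true] (map negb v) = subseq [:: true; false] v.
  elim: v {nv} => //= x v IH; case: x => //=; rewrite ?IH //.
  by rewrite !sub1seq -[true]/(negb false) (mem_map (can_inj negbK)).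
move=> /(_ nv) /=; case: v {nv} => [|[] v] //=; lia.
Qed.

(** [v] consists of falses followed by trues, and its falses merge into the final false of the left
    part. *)
Lemma runs_cat_rising p v : ~~ subseq [:: true; false] v ->
  runs (rcons p false ++ v) <= (runs (rcons p false)).+1.
Proof.
move=> nv; rewrite -cats1 -catA /=.
have := @runs_cat_ohead p (false :: v) [:: false] erefl.
have := runs_rising nv; rewrite /=; lia.
Qed.

Lemma runs_cat_mono u v : runs v <= runs (u ++ v).
Proof. by elim: u => //= x u IH; lia. Qed.

(** The last run of [x] in [u] cannot merge into [v], so it comes on top of the runs of [v]. *)
Lemma runs_cat_new x u v : x \in u -> ohead v != Some x ->
  runs v < runs (u ++ v).
Proof.
move=> xu hv; elim: u xu => // y u IH; rewrite inE.
case: (boolP (x \in u)) => [xu _|xu]; first by have := IH xu; rewrite /=; lia.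
rewrite orbF => /eqP <- {IH} /=.
suff -> : ohead (u ++ v) != Some x by rewrite add1n ltnS runs_cat_mono.
case: u xu => //= z u; rewrite inE negb_or eq_sym => /andP[/eqP h _].
by apply/eqP => -[].
Qed.

(** * Projection of a word to two symbols *)

Section Proj.
Variable T : eqType.
Implicit Types (a b x : T) (w : seq T).

Definition proj a b w := [seq x == a | x <- w & (x == a) || (x == b)].

Lemma proj_cat a b u v : proj a b (u ++ v) = proj a b u ++ proj a b v.
Proof. by rewrite /proj filter_cat map_cat. Qed.

Lemma projC a b w : a != b -> proj b a w = map negb (proj a b w).
Proof.
move=> ab; rewrite /proj -map_comp.
have -> : [seq x <- w | (x == b) || (x == a)] = [seq x <- w | (x == a) || (x == b)].
  by apply: eq_filter => x; rewrite orbC.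
apply/eq_in_map => x; rewrite mem_filter => /andP[+ _] /=.
by case/orP => /eqP ->; rewrite eqxx ?(negbTE ab) // eq_sym (negbTE ab).
Qed.

Lemma runs_projC a b w : a != b -> runs (proj b a w) = runs (proj a b w).
Proof. by move=> ab; rewrite projC // runs_negb. Qed.

Lemma mem_proj a b w y : a != b ->
  (y \in proj a b w) = ((if y then a else b) \in w).
Proof.
move=> ab; apply/mapP/idP => [[x]|].
  rewrite mem_filter => /andP[+ xw] ->.
  by case/orP => /eqP xE; subst x; rewrite ?eqxx // eq_sym (negbTE ab).
move=> h; exists (if y then a else b).
  by rewrite mem_filter h andbT; case: y {h}; rewrite eqxx ?orbT.
by case: y {h}; rewrite ?eqxx // eq_sym (negbTE ab).
Qed.

Lemma proj_notin a b w : a \notin w -> b \notin w -> proj a b w = [::].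
Proof.
elim: w => //= x w IH; rewrite !inE !negb_or => /andP[ax aw] /andP[bx bw].
have -> : proj a b (x :: w) = proj a b w; last exact: IH.
by rewrite /proj /= eq_sym (negbTE ax) eq_sym (negbTE bx).
Qed.

Lemma subseq_proj a b w (y : bool) : a != b ->
  subseq [:: y; ~~ y] (proj a b w) =
  subseq (if y then [:: a; b] else [:: b; a]) w.
Proof.
move=> ab; elim: w => [|x w IH]; first by case: y.
have -> : proj a b (x :: w) = proj a b [:: x] ++ proj a b w by rewrite -proj_cat.
rewrite subseq2_cat {}IH.
have -> : subseq (if y then [:: a; b] else [:: b; a]) (x :: w) =
  [|| subseq (if y then [:: a; b] else [:: b; a]) w |
      (x == if y then a else b) && ((if y then b else a) \in w)].
  by rewrite -(cat1s x w); case: y; rewrite subseq2_cat /= inE (eq_sym x); case: ifP.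
have -> : subseq [:: y; ~~ y] (proj a b [:: x]) = false.
  by rewrite /proj /=; case: ifP => //= _; case: ifP.
by rewrite !mem_proj // inE eq_sym; case: y.
Qed.

Lemma size_proj a b w : a != b -> size (proj a b w) = count_mem a w + count_mem b w.
Proof.
move=> ab; rewrite size_map size_filter; elim: w => //= x w ->.
by have [->|] := eqVneq x a; rewrite ?(negbTE ab) /=; lia.
Qed.

Lemma proj_notin_r a b w : a != b -> b \notin w ->
  proj a b w = nseq (count_mem a w) true.
Proof.
move=> ab bw; have := size_proj w ab.
rewrite (count_memPn bw) addn0 => <-; apply/all_pred1P/allP => -[] //.
by rewrite mem_proj // (negbTE bw).
Qed.

Lemma proj_notin_l a b w : a != b -> a \notin w ->
  proj a b w = nseq (count_mem b w) false.
Proof.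
by move=> ab aw; rewrite projC 1?eq_sym // proj_notin_r 1?eq_sym // map_nseq.
Qed.

End Proj.

(** * Words cut into blocks *)

(* A word cut into blocks; the flag marks the special blocks, the ones that the
   recursive construction expands and fuses. *)
Definition blocks (T : Type) := seq (bool * seq T).

Section Blocks.
Variable T : eqType.
Implicit Types (a b x : T) (w : seq T) (W : blocks T) (U V B : seq T) (P : pred bool).

Definition symb P W : seq T := flatten [seq p.2 | p <- W & P p.1].
Definition flat W : seq T := symb predT W.
Definition nblocks P W := count (preim fst P) W.

Lemma symb_cat P W1 W2 : symb P (W1 ++ W2) = symb P W1 ++ symb P W2.
Proof. by rewrite /symb filter_cat map_cat flatten_cat. Qed.

Lemma symb_cons P p B W :
  symb P ((p, B) :: W) = (if P p then B else [::]) ++ symb P W.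
Proof. by rewrite /symb /=; case: (P p). Qed.

Lemma flat_cat W1 W2 : flat (W1 ++ W2) = flat W1 ++ flat W2.
Proof. exact: symb_cat. Qed.

Lemma flat_cons p B W : flat ((p, B) :: W) = B ++ flat W.
Proof. exact: symb_cons. Qed.

Lemma mem_symb P W x : x \in symb P W -> x \in flat W.
Proof.
elim: W => [|[p B] W IH]; rewrite ?symb_cons ?flat_cons // !mem_cat.
by case: (P p) => /orP[|/IH->]; rewrite ?orbT // => ->.
Qed.

Lemma mem_block p B W x : (p, B) \in W -> x \in B -> x \in flat W.
Proof.
elim: W => // -[q C] W IH; rewrite inE flat_cons mem_cat => /orP[/eqP[_ ->] ->//|].
by move=> /IH h /h ->; rewrite orbT.
Qed.

Lemma nblocks_cat P W1 W2 : nblocks P (W1 ++ W2) = nblocks P W1 + nblocks P W2.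
Proof. exact: count_cat. Qed.

(* For a before b in the special block B, with U before B and V after it, the
   word reads a..ab..b in U and b..ba..a in V.  Hence two symbols share at most
   one special block, and expanding that block adds few alternations. *)
Definition nested U B V := forall a b, subseq [:: a; b] B ->
  ~~ subseq [:: b; a] U /\ ~~ subseq [:: a; b] V.

Lemma nested_cons x U B V : nested U B V ->
  (forall b, b \in B -> ~~ subseq [:: b; x] U /\ ~~ subseq [:: x; b] V) ->
  nested U (x :: B) V.
Proof.
move=> nB xB a b /=; case: eqP => [->|_]; last exact: nB.
by rewrite sub1seq => /xB.
Qed.

Fixpoint nest U W V : Prop :=
  if W is (p, B) :: W' then
    (p -> nested U B (flat W' ++ V)) /\ nest (U ++ B) W' V
  else True.

Fixpoint lasts W V : Prop :=
  if W is (p, B) :: W' then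
    (p -> forall x, x \in B -> x \notin flat W' ++ V) /\ lasts W' V
  else True.

Lemma nest_cat U W1 W2 V : nest U (W1 ++ W2) V <->
  nest U W1 (flat W2 ++ V) /\ nest (U ++ flat W1) W2 V.
Proof.
elim: W1 U => [|[p B] W1 IH] U /=; first by rewrite cats0; split=> [|[]].
rewrite flat_cat flat_cons -!catA.
have := IH (U ++ B); rewrite -!catA => -[H1 H2].
split=> [[h /H1[]]|[[h1 h2] h3]] //.
by split=> //; apply: H2.
Qed.

Lemma lasts_cat W1 W2 V : lasts (W1 ++ W2) V <->
  lasts W1 (flat W2 ++ V) /\ lasts W2 V.
Proof.
elim: W1 => [|[p B] W1 IH] /=; first by split=> [|[]].
rewrite flat_cat -!catA; case: IH => H1 H2.
by split=> [[h /H1[]]|[[h1 h2] h3]] //; split=> //; apply: H2.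
Qed.

Lemma nblocks_split n W : n < nblocks id W ->
  exists W1 B W2, W = W1 ++ (true, B) :: W2 /\ nblocks id W1 = n.
Proof.
elim: W n => [|[[] B] W IH] n //=.
- case: n => [|n]; first by exists [::], B, W.
  rewrite add1n ltnS => /IH[W1 [C [W2 [-> <-]]]].
  by exists ((true, B) :: W1), C, W2.
- rewrite add0n => /IH[W1 [C [W2 [-> <-]]]].
  by exists ((false, B) :: W1), C, W2.
Qed.

Lemma runs_proj0 a b w : a != b -> a \notin w -> runs (proj a b w) <= 1.
Proof.
move=> ab aw; have := @runs_falling (proj a b w) [::].
rewrite cats0 (subseq_proj w false ab).
case: (boolP (subseq _ _)) => [/subseq2_mem[_]|_ /(_ isT)] /=.
  by rewrite (negbTE aw).
case E: (proj a b w) => [|[] u] //=.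
by have := mem_proj w true ab; rewrite E inE /= (negbTE aw).
Qed.

Lemma runs_proj1 a b w : a != b -> count_mem a w <= 1 -> runs (proj a b w) <= 3.
Proof.
move=> ab cw; have [|aw] := boolP (a \in w); last exact: leq_trans (runs_proj0 ab aw) _.
move=> aw; case/splitPr: aw cw => u v cw.
move: cw; rewrite count_cat /= eqxx => cw.
have [au av] : a \notin u /\ a \notin v by rewrite -!has_pred1 !has_count; lia.
have -> : proj a b (u ++ a :: v) = proj a b u ++ [:: true] ++ proj a b v.
  by rewrite proj_cat; congr (_ ++ _); rewrite {1}/proj /= eqxx /= eqxx.
have := runs_cat (proj a b u) ([:: true] ++ proj a b v).
have := runs_cat [:: true] (proj a b v).
by move: (runs_proj0 ab au) (runs_proj0 ab av) => /=; lia.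
Qed.

Lemma uniq_subseq2 a b w : uniq w -> a != b -> a \in w -> b \in w ->
  subseq [:: a; b] w || subseq [:: b; a] w.
Proof.
move=> uw ab aw; case/splitPr: w / aw uw => u v _.
rewrite mem_cat inE eq_sym (negbTE ab) -(cat1s a v) !subseq2_cat !mem_cat.
by rewrite !inE eqxx /=; case/orP => ->; rewrite ?andbT ?orbT.
Qed.

Lemma runs_uniq a b w : a != b -> uniq w -> runs (proj a b w) <= 2.
Proof.
move=> ab uw; apply: leq_trans (runs_size _) _.
rewrite size_proj // !count_uniq_mem //; by case: (_ \in _); case: (_ \in _).
Qed.

Lemma nest_uniq U W V : uniq (U ++ flat W ++ V) -> nest U W V.
Proof.
elim: W U => //= -[p B] W IH U; rewrite flat_cons => uw; split; last first.
  by apply: IH; rewrite -!catA in uw *.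
move=> _ a b /subseq2_mem[aB bB]; move: uw.
rewrite -catA cat_uniq has_cat negb_or => /and3P[_ /andP[/hasPn hU _]].
rewrite cat_uniq => /and3P[_ /hasPn hV _].
split; apply/negP => /subseq2_mem[]; first by have := hU _ bB => /= /negbTE ->.
by move=> /hV; rewrite aB.
Qed.

Lemma lasts_uniq W V : uniq (flat W ++ V) -> lasts W V.
Proof.
elim: W => //= -[p B] W IH; rewrite flat_cons -catA cat_uniq.
case/and3P => _ /hasPn hV uW; split; last exact: IH.
by move=> _ x xB; apply/negP => /hV; rewrite /= xB.
Qed.

Lemma size_sum_count (u w : seq T) : uniq u -> {subset w <= u} ->
  size w = \sum_(x <- u) count_mem x w.
Proof.
move=> uu; elim: w => [|y w IH] sw; first by rewrite big1_seq.
rewrite /= IH; last by move=> x xw; apply: sw; rewrite inE xw orbT.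
rewrite big_split /= -[in LHS]add1n; congr (_ + _).
rewrite (bigD1_seq y) ?sw ?mem_head //= eqxx big1 //.
by move=> x; rewrite eq_sym => /negbTE ->.
Qed.

Definition block_sizes m W :=
  all (fun p => uniq p.2 && (p.1 ==> (size p.2 == m))) W.

(** [s] is the order, [l] asks that special blocks hold only last occurrences, [m] is the length of
    special blocks, and [cs], [cn] count the occurrences of each symbol in special and in nonspecial
    blocks. Nestedness is kept apart because an expansion may destroy it, while fusing restores
    it. *)
Definition prelayout s (l : bool) m cs cn W : Prop :=
  [/\ block_sizes m W,
      forall a b, a != b -> runs (proj a b (flat W)) <= s.+1,
      l -> lasts W [::] &
      forall x, x \in flat W -> count_mem x (symb id W) = cs /\
                                count_mem x (symb negb W) = cn].

Definition layout s l m cs cn W : Prop :=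
  prelayout s l m cs cn W /\ nest [::] W [::].

Definition nsym W := size (undup (flat W)).

Lemma block_sizesP m W : block_sizes m W <->
  all (fun p => uniq p.2) W /\ all (fun p => p.1 ==> (size p.2 == m)) W.
Proof. by rewrite /block_sizes all_predI; split=> [/andP|[-> ->]]. Qed.

(** Double counting of the occurrences in special blocks, by symbol and by block. *)
Lemma nsym_special m cs W : block_sizes m W ->
  (forall x, x \in flat W -> count_mem x (symb id W) = cs) ->
  nsym W * cs = nblocks id W * m.
Proof.
case/block_sizesP => _ sW cW; have -> : nblocks id W * m = size (symb id W).
  elim: W sW {cW} => //= -[p B] W IH /= /andP[pB /IH].
  by rewrite symb_cons size_cat; case: p pB => /= [/eqP ->|_]; lia.
rewrite (@size_sum_count (undup (flat W))) ?undup_uniq //; last first.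
  by move=> x /mem_symb; rewrite mem_undup.
rewrite (eq_big_seq (fun=> cs)); last by move=> x; rewrite mem_undup => /cW.
by rewrite big_const_seq count_predT iter_addn_0 mulnC.
Qed.

End Blocks.

(** * Fusing a word with copies of another one *)

Section Embedding.
Variables (A C : eqType) (g : A -> C) (h : C -> option A).
Hypotheses (gK : pcancel g h) (hK : ocancel h g).

(** Questions about embedded symbols reduce to the word left after deleting everything outside the
    image of [g]. *)
Lemma mem_pmap_embed x w : (g x \in w) = (x \in pmap h w).
Proof. by rewrite -(mem_map (pcan_inj gK)) (pmap_filter hK) mem_filter gK. Qed.

Lemma embed_cons c w :
  pmap h (c :: w) = (if h c is Some x then x :: pmap h w else pmap h w).
Proof. by rewrite /=; case: (h c). Qed.

Lemma eq_embed x c : (c == g x) = (h c == Some x).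
Proof.
apply/eqP/eqP => [->|]; first exact: gK.
by have := hK c; case: (h c) => //= y <- [->].
Qed.

Lemma count_embed x w : count_mem (g x) w = count_mem x (pmap h w).
Proof.
elim: w => // c w IH; rewrite embed_cons /= eq_embed IH.
by case: (h c) => //= y.
Qed.

Lemma subseq2_embed x y w :
  subseq [:: g x; g y] w = subseq [:: x; y] (pmap h w).
Proof.
elim: w => // c w IH; rewrite embed_cons /= (eq_sym (g x)) eq_embed.
case: (h c) => [z|] //=; rewrite -[Some z == _]/(z == x) (eq_sym x).
by case: ifP => //; rewrite !sub1seq mem_pmap_embed.
Qed.

Lemma proj_embed x y w : proj (g x) (g y) w = proj x y (pmap h w).
Proof.
elim: w => // c w IH; rewrite embed_cons.
have -> : proj (g x) (g y) (c :: w) =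
    (if (c == g x) || (c == g y) then [:: c == g x] else [::]) ++ proj (g x) (g y) w.
  by rewrite /proj /=; case: ifP.
rewrite IH !eq_embed; case: (h c) => [z|] //.
by rewrite -![Some z == _]/(z == _) /proj /=; case: ifP.
Qed.

End Embedding.

Section Fuse.
Variables (T1 T2 : eqType).
Local Notation T := (T1 + nat * T2)%type.
Implicit Types (W : blocks T1) (Z : blocks T2) (B : seq T1) (i j : nat) (P : pred bool).

Definition copy i (c : T2) : T := inr (i, c).
Definition old (y : T) : option T1 := if y is inl x then Some x else None.
Definition uncopy i (y : T) : option T2 :=
  if y is inr (j, c) then (if j == i then Some c else None) else None.

Lemma oldK : pcancel inl old. Proof. by []. Qed.
Lemma oldK' : ocancel old inl. Proof. by case. Qed.
Lemma copyK i : pcancel (copy i) (uncopy i).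
Proof. by move=> c; rewrite /= eqxx. Qed.
Lemma copyK' i : ocancel (uncopy i) (copy i).
Proof. by case=> // -[j c] /=; case: eqP => //= ->. Qed.

(* The i-th copy of Z, with the successive elements of B put in front of its
   successive special blocks. *)
Fixpoint plug i B Z : blocks T :=
  match Z, B with
  | (true, C) :: Z', x :: B' =>
      (true, inl x :: map (copy i) C) :: plug i B' Z'
  | (p, C) :: Z', _ => (p, map (copy i) C) :: plug i B Z'
  | [::], _ => [::]
  end.

(** [i] names the next copy, so that distinct special blocks of [W] receive disjoint copies of
    [Z]. *)
Fixpoint fuse i W Z : blocks T :=
  match W with
  | (true, B) :: W' => plug i B Z ++ fuse i.+1 W' Z
  | (false, B) :: W' => (false, map inl B) :: fuse i W' Z
  | [::] => [::]
  end.

Lemma fuse_cat i W W' Z :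
  fuse i (W ++ W') Z = fuse i W Z ++ fuse (i + nblocks id W) W' Z.
Proof.
elim: W i => [|[[] B] W IH] i /=; first by rewrite addn0.
  by rewrite IH -catA addSnnS.
by rewrite IH add0n.
Qed.

Lemma pmap_old_copy i C : pmap old (map (copy i) C) = [::].
Proof. by elim: C. Qed.

Lemma pmap_old_inl B : pmap old (map inl B) = B.
Proof. exact: map_pK. Qed.

Lemma pmap_uncopy_copy i j C :
  pmap (uncopy j) (map (copy i) C) = if i == j then C else [::].
Proof. by elim: C => [|c C IH] /=; rewrite ?IH; case: eqP. Qed.

Lemma pmap_uncopy_inl j B : pmap (uncopy j) (map inl B) = [::].
Proof. by elim: B. Qed.

Lemma old_plug i P B Z : size B <= nblocks id Z ->
  pmap old (symb P (plug i B Z)) = if P true then B else [::].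
Proof.
elim: Z B => [|[[] C] Z IH] [|x B] //= sB; try by case: (P true).
- by rewrite symb_cons pmap_cat IH //; case: (P true); rewrite //= pmap_old_copy.
- by rewrite symb_cons pmap_cat IH //; case: (P true); rewrite //= pmap_old_copy.
- by rewrite symb_cons pmap_cat IH //; case: (P false); rewrite //= pmap_old_copy.
- by rewrite symb_cons pmap_cat IH //; case: (P false); rewrite //= pmap_old_copy.
Qed.

Lemma mem_old_plug i P B Z x :
  inl x \in symb P (plug i B Z) -> x \in B.
Proof.
have inl_copy C : (inl x \in map (copy i) C) = false.
  by rewrite (mem_pmap_embed oldK oldK') pmap_old_copy.
elim: Z B => [|[[] C] Z IH] [|y B] //=; rewrite symb_cons mem_cat.
- by case: (P true); rewrite ?inl_copy => /IH.
- rewrite inE; case: (P true); last by move=> /IH ->; rewrite orbT.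
  by rewrite inE inl_copy orbF => /orP[/eqP [->]|/IH ->]; rewrite ?eqxx ?orbT.
- by case: (P false); rewrite ?inl_copy => /IH.
- by case: (P false); rewrite ?inl_copy => /IH.
Qed.

Lemma uncopy_plug i j P B Z :
  pmap (uncopy j) (symb P (plug i B Z)) = if i == j then symb P Z else [::].
Proof.
elim: Z B => [|[[] C] Z IH] [|x B] /=; try (by case: eqP);
  rewrite !symb_cons pmap_cat IH; case: (P true); case: (P false);
  by rewrite /= ?pmap_uncopy_copy; case: (i == j).
Qed.

Lemma nblocks_plug P i B Z :
  nblocks P (plug i B Z) = nblocks P Z.
Proof.
by elim: Z B => [|[[] C] Z IH] [|x B] //=; rewrite IH.
Qed.

Lemma nblocks_fuse P i W Z : nblocks P (fuse i W Z) =
  P false * nblocks negb W + nblocks id W * nblocks P Z.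
Proof.
elim: W i => [|[[] B] W IH] i /=; first by rewrite muln0.
  by rewrite nblocks_cat IH nblocks_plug; lia.
by rewrite IH; lia.
Qed.

(** [plug] drops the elements of [B] for which [Z] has no special block left; this condition
    excludes such a loss. *)
Definition fits W Z :=
  all (fun p => p.1 ==> (size p.2 <= nblocks id Z)) W.

Lemma old_fuse i P W Z : fits W Z ->
  pmap old (symb P (fuse i W Z)) = symb P W.
Proof.
elim: W i => [|[[] B] W IH] i //=; rewrite symb_cons.
  by case/andP => sB fW; rewrite symb_cat pmap_cat old_plug // IH.
move=> fW; by rewrite symb_cons pmap_cat IH //; case: (P false); rewrite //= pmap_old_inl.
Qed.

Lemma uncopy_fuse i j P W Z : pmap (uncopy j) (symb P (fuse i W Z)) =
  if (i <= j < i + nblocks id W) then symb P Z else [::].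
Proof.
elim: W i => [|[[] B] W IH] i /=.
- by rewrite addn0; case: ifP => //; lia.
- rewrite symb_cat pmap_cat uncopy_plug IH; case: eqP => [->|ne].
    by rewrite ltnn /= cats0 leqnn; case: ifP => //; lia.
  by congr (if _ then _ else _); lia.
- rewrite symb_cons pmap_cat IH add0n.
  by case: (P false); rewrite //= pmap_uncopy_inl.
Qed.

End Fuse.

Section FuseLayout.
Variables (T1 T2 : eqType).
Local Notation T := (T1 + nat * T2)%type.
Implicit Types (W : blocks T1) (Z : blocks T2) (B : seq T1) (i j : nat).

Let inlE := mem_pmap_embed (@oldK T1 T2) (@oldK' T1 T2).
Let copyE i := mem_pmap_embed (@copyK T1 T2 i) (@copyK' T1 T2 i).

Lemma inl_copy_all i x (C : seq T2) : (inl x \in map (@copy T1 T2 i) C) = false.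
Proof. by rewrite inlE pmap_old_copy. Qed.

Lemma uniq_plug i B Z : uniq B -> all (fun p => uniq p.2) Z ->
  all (fun p => uniq p.2) (plug i B Z).
Proof.
have injc : injective (@copy T1 T2 i) := pcan_inj (@copyK T1 T2 i).
elim: Z B => [|[[] C] Z IH] [|x B] //= uB /andP[uC uZ];
  rewrite ?inl_copy_all ?(map_inj_uniq injc) ?uC //= IH //.
by case/andP: uB.
Qed.

Lemma uniq_fuse i W Z : all (fun p => uniq p.2) W -> all (fun p => uniq p.2) Z ->
  all (fun p => uniq p.2) (fuse i W Z).
Proof.
move=> + uZ; elim: W i => [|[[] B] W IH] i //= /andP[uB uW].
  by rewrite all_cat uniq_plug //= IH.
by rewrite (map_inj_uniq (@inl_inj _ _)) uB IH.
Qed.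

Lemma size_plug i B Z m : size B = nblocks id Z ->
  all (fun p => p.1 ==> (size p.2 == m)) Z ->
  all (fun p => p.1 ==> (size p.2 == m.+1)) (plug i B Z).
Proof.
elim: Z B => [|[[] C] Z IH] [|x B] //=; [|exact: (IH [::])|exact: (IH (x :: B))].
by rewrite add1n => -[sB] /andP[sC sZ]; rewrite size_map eqSS sC IH.
Qed.

Lemma size_fuse i W Z m :
  all (fun p => p.1 ==> (size p.2 == nblocks id Z)) W ->
  all (fun p => p.1 ==> (size p.2 == m)) Z ->
  all (fun p => p.1 ==> (size p.2 == m.+1)) (fuse i W Z).
Proof.
move=> + sZ; elim: W i => [|[[] B] W IH] i //=.
  by case/andP => /eqP sB sW; rewrite all_cat size_plug //= IH.
exact: IH.
Qed.

(** The copies occupy successive intervals of the word, in the order of their indices. *)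
Lemma copy_order i j j' c c' W Z :
  subseq [:: copy T1 j' c'; copy T1 j c] (flat (fuse i W Z)) -> j' <= j.
Proof.
have mem k x U P : (copy T1 k x \in symb P (plug i U Z)) -> k = i.
  by rewrite copyE uncopy_plug; case: eqP.
have memf k x n U : (copy T1 k x \in flat (fuse n U Z)) -> n <= k.
  by rewrite copyE uncopy_fuse; case: ifP => // /andP[].
elim: W i mem => [|[[] B] W IH] i mem //=.
  rewrite flat_cat subseq2_cat; case/or3P.
  - by move=> /subseq2_mem[/mem -> /mem ->].
  - apply: IH => k x U P; rewrite copyE uncopy_plug; by case: eqP.
  - by case/andP => /mem -> /memf; lia.
rewrite flat_cons subseq2_cat; case/or3P; last 1 first.
- by case/andP; rewrite copyE pmap_uncopy_inl.
- by move=> /subseq2_mem[]; rewrite copyE pmap_uncopy_inl.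
exact: IH.
Qed.

(* An old symbol occurs at most once inside a copy, so the worst case is
   a..a c..c a c..c a..a; its last run is absent when the special blocks hold
   only last occurrences. *)
Lemma runs_mixed s (l : bool) i W Z a j c :
  4 <= s + l -> fits W Z ->
  all (fun p => uniq p.2) W -> (l -> lasts W [::]) ->
  runs (proj (inl a) (copy T1 j c) (flat (fuse i W Z))) <= s.+1.
Proof.
move=> sl fW uW lW; have ac : inl a != copy T1 j c by [].
have no_copy U : pmap (uncopy j) U = [::] ->
    runs (proj (inl a) (copy T1 j c) U) <= 1.
  move=> U0; rewrite -runs_projC //; apply: runs_proj0; first by rewrite eq_sym.
  by rewrite copyE U0.
have [ij|ij] := boolP (i <= j < i + nblocks id W); last first.
  apply: leq_trans (no_copy _ _) _; last lia.
  by rewrite uncopy_fuse (negbTE ij).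
have /nblocks_split[W1 [B [W2 [WE nW1]]]] : j - i < nblocks id W by lia.
have {ij} jE : j = i + nblocks id W1 by lia.
rewrite WE fuse_cat /= -jE !flat_cat !proj_cat.
have := no_copy (flat (fuse i W1 Z)).
rewrite uncopy_fuse jE ltnn andbF => /(_ erefl) r1.
have := no_copy (flat (fuse j.+1 W2 Z)).
rewrite uncopy_fuse ltnn => /(_ erefl) r2.
rewrite -jE in r1 *.
move: uW lW fW; rewrite WE /fits !all_cat /= => /and3P[_ uB _] lW /and3P[_ sB fW2].
have := runs_cat (proj (inl a) (copy T1 j c) (flat (fuse i W1 Z)))
  (proj (inl a) (copy T1 j c) (flat (plug j B Z)) ++
   proj (inl a) (copy T1 j c) (flat (fuse j.+1 W2 Z))).
have := runs_cat (proj (inl a) (copy T1 j c) (flat (plug j B Z)))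
  (proj (inl a) (copy T1 j c) (flat (fuse j.+1 W2 Z))).
have [aB|aB] := boolP (a \in B); last first.
  have := @runs_proj0 _ (inl a) (copy T1 j c) (flat (plug j B Z)) ac.
  rewrite inlE old_plug // aB => /(_ isT) r0 h1 h2; apply: leq_trans h2 _.
  apply: leq_trans (leq_add r1 (leq_trans h1 (leq_add r0 r2))) _.
  by case: l sl {lW} => sl; lia.
have : runs (proj (inl a) (copy T1 j c) (flat (plug j B Z))) <= 3.
  apply: runs_proj1 => //.
  rewrite (count_embed (@oldK T1 T2) (@oldK' T1 T2)) old_plug //=.
  by rewrite count_uniq_mem // leq_b1.
move=> r0 h1 h2; apply: leq_trans h2 _.
case: l sl lW => sl lW; last first.
  by apply: leq_trans (leq_add r1 (leq_trans h1 (leq_add r0 r2))) _; lia.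
have {r2} -> : proj (inl a) (copy T1 j c) (flat (fuse j.+1 W2 Z)) = [::].
  apply: proj_notin; last by rewrite copyE uncopy_fuse ltnn.
  rewrite inlE old_fuse //; have /lasts_cat[_ /= [/(_ isT a aB)]] := lW isT.
  by rewrite cats0.
rewrite cats0; apply: leq_trans (leq_add r1 r0) _; lia.
Qed.

Lemma nested_copy i C U V :
  nested (pmap (uncopy i) U) C (pmap (uncopy i) V) ->
  nested U (map (@copy T1 T2 i) C) V.
Proof.
move=> nC a b /[dup] /subseq2_mem[/mapP[c cC ->] /mapP[d dC ->]].
rewrite !(subseq2_embed (@copyK T1 T2 i) (@copyK' T1 T2 i)).
by rewrite pmap_uncopy_copy eqxx => /nC.
Qed.

Lemma nest_plug i B Z U V :
  nest (pmap (uncopy i) U) Z [::] -> pmap (uncopy i) V = [::] -> uniq B ->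
  (forall x c, x \in B -> ~~ subseq [:: copy T1 i c; inl x] U) ->
  nest U (plug i B Z) V.
Proof.
elim: Z B U => [|[p C] Z IH] B U //= [nC nZ] V0 uB BU.
have nested_C B' : p -> nested U (map (@copy T1 T2 i) C) (flat (plug i B' Z) ++ V).
  move=> pT; apply: nested_copy; rewrite pmap_cat uncopy_plug eqxx V0.
  exact: nC.
have step B' (X : seq T) : pmap (uncopy i) X = C ->
    {subset B' <= B} -> uniq B' ->
    (forall x, x \in B' -> inl x \notin X) -> nest (U ++ X) (plug i B' Z) V.
  move=> XC sB uB' B'X; apply: IH => //; first by rewrite pmap_cat XC.
  move=> x c xB'; rewrite subseq2_cat !negb_or BU ?sB //=.
  rewrite (negbTE (B'X _ xB')) andbF andbT.
  by apply/negP => /subseq2_mem[_]; rewrite (negbTE (B'X _ xB')).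
case: p nC nested_C => [nC|_] nested_C; last first.
  split=> //; apply: step => //; first by rewrite pmap_uncopy_copy eqxx.
  by move=> x; rewrite inl_copy_all.
case: B uB BU step => [|x B] uB BU step.
  split=> [_|]; first exact: nested_C.
  by apply: step; rewrite ?pmap_uncopy_copy ?eqxx.
case/andP: uB => xB uB; split=> [_|].
  apply: nested_cons; first exact: nested_C.
  move=> b /mapP[c cC ->]; split; first by apply: BU; rewrite mem_head.
  rewrite subseq2_cat !negb_or; apply/and3P; split.
  - apply/negP => /subseq2_mem[/mem_old_plug]; by rewrite (negbTE xB).
  - by apply/negP => /subseq2_mem[_]; rewrite copyE V0.
  - by rewrite copyE V0 andbF.
apply: step => //; first by rewrite /= pmap_uncopy_copy eqxx.
  by move=> y yB; rewrite inE yB orbT.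
move=> y yB; rewrite inE inl_copy_all orbF.
by apply: contra xB => /eqP[<-].
Qed.

(** A special block of the result contains at most one old symbol, so two old symbols never share
    one; the other pairs are handled copy by copy. *)
Lemma nest_fuse i W Z U : all (fun p => uniq p.2) W -> nest [::] Z [::] ->
  (forall j, i <= j -> pmap (uncopy j) U = [::]) -> nest U (fuse i W Z) [::].
Proof.
move=> + nZ; elim: W i U => [|[[] B] W IH] i U //= /andP[uB uW] U0.
  apply/nest_cat; split.
    apply: nest_plug => //; first by rewrite U0.
      by rewrite cats0 uncopy_fuse ltnn.
    by move=> x c _; apply/negP => /subseq2_mem[]; rewrite copyE U0.
  apply: IH => // j ij; rewrite pmap_cat U0 ?(ltnW ij) // uncopy_plug.
  by case: eqP => // ji; move: ij; rewrite ji ltnn.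
split=> //; apply: IH => // j ij.
by rewrite pmap_cat U0 // pmap_uncopy_inl.
Qed.

Lemma lasts_plug i B Z V : lasts Z [::] -> uniq B ->
  (forall x, x \in B -> inl x \notin V) -> pmap (uncopy i) V = [::] ->
  lasts (plug i B Z) V.
Proof.
move=> + + + V0; elim: Z B => [|[p C] Z IH] B //= [lC lZ] uB BV.
have lC' B' c : p -> c \in map (@copy T1 T2 i) C -> c \notin flat (plug i B' Z) ++ V.
  move=> pT /mapP[d dC ->]; rewrite copyE pmap_cat uncopy_plug eqxx V0.
  exact: lC.
case: p lC lC' => [lC|_] lC'; last by split=> //; apply: IH.
case: B uB BV => [|x B] uB BV; first by split=> [_ x|]; [exact: lC'|exact: IH].
case/andP: uB => xB uB; split=> [_ y|]; last first.
  by apply: IH => // y yB; apply: BV; rewrite inE yB orbT.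
rewrite inE => /orP[/eqP ->|]; last exact: lC'.
rewrite mem_cat negb_or BV ?mem_head // andbT.
by apply: contra xB => /mem_old_plug.
Qed.

Lemma lasts_fuse i W Z : fits W Z -> all (fun p => uniq p.2) W ->
  lasts W [::] -> lasts Z [::] -> lasts (fuse i W Z) [::].
Proof.
move=> + + + lZ; elim: W i => [|[[] B] W IH] i //=; last first.
  by move=> fW /andP[uB uW] [lB lW]; split=> //; apply: IH.
case/andP => sB fW /andP[uB uW] [lB lW].
apply/lasts_cat; split; last exact: IH.
apply: lasts_plug => //; last by rewrite cats0 uncopy_fuse ltnn.
by move=> x /(lB isT); rewrite !cats0 inlE old_fuse.
Qed.

Lemma runs_fuse s (l : bool) i W Z :
  4 <= s + l -> fits W Z -> all (fun p => uniq p.2) W -> (l -> lasts W [::]) ->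
  (forall a b, a != b -> runs (proj a b (flat W)) <= s.+1) ->
  (forall a b, a != b -> runs (proj a b (flat Z)) <= s.+1) ->
  forall a b, a != b -> runs (proj a b (flat (fuse i W Z))) <= s.+1.
Proof.
move=> sl fW uW lW rW rZ [a|[j c]] [b|[k d]] ab.
- rewrite (proj_embed (@oldK T1 T2) (@oldK' T1 T2)) old_fuse //; apply: rW.
  by apply: contra ab => /eqP ->.
- exact: (runs_mixed (l := l)).
- by rewrite -runs_projC // (runs_mixed (l := l)).
have [jk|jk] := eqVneq j k.
  subst k; rewrite (proj_embed (@copyK T1 T2 j) (@copyK' T1 T2 j)) uncopy_fuse.
  case: ifP => // _; apply: rZ; by apply: contra ab => /eqP ->.
wlog {jk} jk : j k c d ab / j < k => [H|].
  have /orP[|kj] : (j < k) || (k < j) by lia.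
    exact: H.
  by rewrite -runs_projC //; apply: H => //; rewrite eq_sym.
(* Copy [j] ends before copy [k] starts, so the projection has at most two runs. *)
have nf : ~~ subseq [:: false; ~~ false]
    (proj (copy T1 j c) (copy T1 k d) (flat (fuse i W Z))).
  by rewrite subseq_proj //; apply/negP => /copy_order; rewrite leqNgt jk.
have := @runs_falling _ [::] nf; rewrite cats0 /= => h; apply: leq_trans h _.
by case: (_ == _); lia.
Qed.

(** A special block of [W] has one element for each special block of [Z], so every special block
    grows by exactly one symbol. *)
Lemma layout_fuse s (l : bool) m cs cn W Z :
  4 <= s + l ->
  prelayout s l (nblocks id Z) cs cn W -> layout s l m cs cn Z ->
  layout s l m.+1 cs cn (fuse 0 W Z).
Proof.
move=> sl [/block_sizesP[uW sW] rW lW cW] [[/block_sizesP[uZ sZ] rZ lZ cZ] nZ].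
have fW : fits W Z by apply: sub_all sW => p /implyP h; apply/implyP => /h /eqP ->.
split; last exact: nest_fuse.
split.
- by apply/block_sizesP; split; [exact: uniq_fuse|exact: size_fuse].
- exact: (runs_fuse (l := l)).
- by move=> lT; apply: lasts_fuse => //; [exact: lW|exact: lZ].
case=> [a|[j c]].
  rewrite !(count_embed (@oldK T1 T2) (@oldK' T1 T2)) inlE !old_fuse //.
  exact: cW.
rewrite !(count_embed (@copyK T1 T2 j) (@copyK' T1 T2 j)) copyE !uncopy_fuse.
by case: ifP => // _; exact: cZ.
Qed.

End FuseLayout.

(** * Expanding special blocks *)

Section Relabel.
Variables (T1 T2 : eqType) (h : T1 -> T2).
Implicit Types (Z : blocks T1) (w : seq T1).

Lemma symb_map P Z :
  symb P [seq (p.1, map h p.2) | p <- Z] = map h (symb P Z).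
Proof.
elim: Z => // -[p C] Z IH; rewrite /= !symb_cons IH map_cat.
by case: (P p).
Qed.

Variable S : seq T1.
Hypothesis h_inj : {in S &, injective h}.

Lemma eq_in_inj x y : x \in S -> y \in S -> (h x == h y) = (x == y).
Proof. by move=> xS yS; apply/eqP/eqP => [/h_inj->|->]. Qed.

Lemma mem_map_in x w : x \in S -> {subset w <= S} -> (h x \in map h w) = (x \in w).
Proof.
move=> xS wS; apply/mapP/idP => [[y yw /h_inj]|xw]; last by exists x.
by move=> /(_ xS (wS _ yw)) ->.
Qed.

Lemma count_map_in x w : x \in S -> {subset w <= S} ->
  count_mem (h x) (map h w) = count_mem x w.
Proof.
move=> xS wS; rewrite count_map; apply: eq_in_count => y /wS yS /=.
exact: eq_in_inj.
Qed.

Lemma proj_map_in x y w : x \in S -> y \in S -> {subset w <= S} ->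
  proj (h x) (h y) (map h w) = proj x y w.
Proof.
move=> xS yS wS; rewrite /proj filter_map -map_comp.
have -> : [seq z <- w | preim h (fun z => (z == h x) || (z == h y)) z] =
          [seq z <- w | (z == x) || (z == y)].
  by apply: eq_in_filter => z /wS zS /=; rewrite !eq_in_inj.
apply/eq_in_map => z; rewrite mem_filter => /andP[_ /wS zS] /=.
exact: eq_in_inj.
Qed.

Lemma subseq2_map_in x y w : x \in S -> y \in S -> {subset w <= S} ->
  subseq [:: h x; h y] (map h w) = subseq [:: x; y] w.
Proof.
move=> xS yS; elim: w => // z w IH wS.
have wS' : {subset w <= S} by move=> t tw; apply: wS; rewrite inE tw orbT.
rewrite /= (eq_in_inj xS (wS _ (mem_head _ _))); case: ifP => _; last exact: IH.
by rewrite !sub1seq mem_map_in.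
Qed.

Lemma lasts_map Z V V' : {subset flat Z <= S} -> lasts Z V ->
  (forall x, x \in flat Z -> h x \notin V') ->
  lasts [seq (p.1, map h p.2) | p <- Z] V'.
Proof.
elim: Z => //= -[p C] Z IH; rewrite flat_cons => ZS [lC lZ] ZV; split=> [pT y|].
  case/mapP => x xC ->; rewrite mem_cat negb_or ZV ?mem_cat ?xC // andbT.
  rewrite /flat symb_map mem_map_in.
  - by have := lC pT _ xC; rewrite mem_cat negb_or => /andP[].
  - by apply: ZS; rewrite mem_cat xC.
  - by move=> z zZ; apply: ZS; rewrite mem_cat zZ orbT.
apply: IH => // z zZ; first by apply: ZS; rewrite mem_cat zZ orbT.
by apply: ZV; rewrite mem_cat zZ orbT.
Qed.

End Relabel.

Section Expand.
Variables (T1 T2 : eqType) (Z : blocks T1).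
Implicit Types (W : blocks T2) (B : seq T2) (P : pred bool).

(* Symbols of Z, in the order of their last occurrences (undup keeps the last
   copy), are sent to the successive elements of B; the case B = [::] is junk. *)
Definition relabel B : blocks T2 :=
  if B is y :: _ then
    [seq (p.1, [seq nth y B (index x (undup (flat Z))) | x <- p.2]) | p <- Z]
  else [::].

Fixpoint expand W : blocks T2 :=
  match W with
  | (true, B) :: W' => relabel B ++ expand W'
  | (false, B) :: W' => (false, B) :: expand W'
  | [::] => [::]
  end.

Hypothesis Z_gt0 : 0 < nsym Z.

(** Replaces the encoding by indices with an injection that carries the order of last occurrences in
    [Z] to the order of [B]. *)
Lemma relabelE B : uniq B -> size B = nsym Z -> exists h : T1 -> T2,
  [/\ {in flat Z &, injective h}, map h (undup (flat Z)) = B &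
      relabel B = [seq (p.1, map h p.2) | p <- Z]].
Proof.
case: B => [_ sB|y B]; first by move: Z_gt0; rewrite -sB.
move=> uB sB; exists (fun x => nth y (y :: B) (index x (undup (flat Z)))); split=> //.
  move=> x x' xZ x'Z /eqP; rewrite nth_uniq ?sB ?index_mem ?mem_undup //.
  by move=> /eqP /(congr1 (nth x (undup (flat Z)))); rewrite !nth_index ?mem_undup.
apply: (@eq_from_nth _ y); first by rewrite size_map.
move=> i; rewrite size_map => iZ.
case E: (undup (flat Z)) (iZ) => [//|x0 u0] _; rewrite -E.
by rewrite (nth_map x0) // index_uniq // undup_uniq.
Qed.

Lemma mem_relabel B : uniq B -> size B = nsym Z -> flat (relabel B) =i B.
Proof.
move=> uB sB y; have [h [_ hB ->]] := relabelE uB sB.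
rewrite /flat symb_map -hB; apply/mapP/mapP => -[x xZ ->]; exists x => //.
  by rewrite mem_undup.
by rewrite -mem_undup.
Qed.

Lemma block_sizes_expand m W : block_sizes m Z -> block_sizes (nsym Z) W ->
  block_sizes m (expand W).
Proof.
move=> bZ; elim: W => [|[[] B] W IH] //= /andP[/andP[uB sB] bW]; last first.
  by rewrite /block_sizes /= uB; apply: IH.
rewrite /block_sizes all_cat; apply/andP; split; last exact: IH.
have [h [hi _ ->]] := relabelE uB (eqP sB).
apply/allP => _ /mapP[[p C] pC ->] /=; have := allP bZ _ pC.
rewrite /= size_map => /andP[uC ->]; rewrite andbT map_inj_in_uniq //.
by move=> x y xC yC; apply: hi; apply: mem_block pC _.
Qed.

Lemma mem_expand W : block_sizes (nsym Z) W -> flat (expand W) =i flat W.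
Proof.
elim: W => [|[[] B] W IH] //= /andP[/andP[uB sB] /IH {}IH] x.
  by rewrite flat_cat flat_cons !mem_cat IH mem_relabel // (eqP sB).
by rewrite !flat_cons !mem_cat IH.
Qed.

Lemma nblocks_expand P W : block_sizes (nsym Z) W -> nblocks P (expand W) =
  P false * nblocks negb W + nblocks id W * nblocks P Z.
Proof.
elim: W => [|[[] B] W IH] //=; first by rewrite muln0.
  move=> /andP[/andP[uB /eqP sB] /IH {}IH]; rewrite nblocks_cat IH.
  have [h [_ _ ->]] := relabelE uB sB.
  by rewrite /nblocks count_map (eq_count (a2 := preim fst P)) //; lia.
by move=> /andP[_ /IH ->]; lia.
Qed.

Lemma count_expand P c W x : block_sizes (nsym Z) W ->
  (forall z, z \in flat Z -> count_mem z (symb P Z) = c) ->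
  count_mem x (symb P (expand W)) =
  P false * count_mem x (symb negb W) + count_mem x (symb id W) * c.
Proof.
move=> + cZ; elim: W => [|[[] B] W IH] //=; first by rewrite muln0.
  move=> /andP[/andP[uB /eqP sB] /IH {}IH]; rewrite symb_cat !symb_cons !count_cat IH /=.
  suff -> : count_mem x (symb P (relabel B)) = count_mem x B * c by lia.
  have [h [hi hB ->]] := relabelE uB sB; rewrite symb_map (count_uniq_mem x uB).
  have sP : {subset symb P Z <= flat Z} by move=> z /mem_symb.
  case: (boolP (x \in B)) => [|xB].
    rewrite -hB => /mapP[z]; rewrite mem_undup => zZ ->.
    by rewrite (count_map_in hi) // cZ // mul1n.
  apply/eqP; rewrite mul0n -leqn0 leqNgt -has_count has_pred1.
  apply: contra xB => /mapP[z /sP zZ ->]; rewrite -hB map_f //.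
  by rewrite mem_undup.
move=> /andP[_ /IH {}IH]; rewrite !symb_cons !count_cat IH /=.
by case: (P false) => /=; lia.
Qed.

Lemma lasts_expand W : block_sizes (nsym Z) W -> lasts Z [::] ->
  lasts W [::] -> lasts (expand W) [::].
Proof.
move=> + lZ; elim: W => [|[[] B] W IH] //=; last first.
  by move=> /andP[_ bW] [_ lW]; split=> //; apply: IH.
move=> /andP[/andP[uB /eqP sB] bW] [lB lW]; apply/lasts_cat; split; last exact: IH.
have [h [hi hB ->]] := relabelE uB sB; apply: (lasts_map (V := [::]) hi) => //.
move=> z zZ; rewrite cats0 mem_expand //; have := lB isT (h z).
by rewrite cats0; apply; rewrite -hB map_f // mem_undup.
Qed.

Definition unshared (a b : T2) W :=
  all (fun p => p.1 ==> ~~ ((a \in p.2) && (b \in p.2))) W.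

Lemma unsharedC a b W : unshared a b W = unshared b a W.
Proof. by apply: eq_all => p; rewrite andbC. Qed.

Lemma runs_nseq_cat (x : bool) n r r' : 0 < n ->
  runs r = runs r' -> ohead r = ohead r' ->
  runs (nseq n x ++ r) = runs (x :: r') /\
  ohead (nseq n x ++ r) = ohead (x :: r').
Proof.
case: n => // n _ e e'; split=> //; elim: n => [|n IH] /=; first by rewrite e e'.
by rewrite eqxx add0n.
Qed.

(** A special block contains at most one of [a] and [b], and its expansion only repeats that symbol.
    The claim on first letters lets the induction glue the pieces. *)
Lemma runs_expand_unshared a b W : a != b -> block_sizes (nsym Z) W ->
  unshared a b W ->
  runs (proj a b (flat (expand W))) = runs (proj a b (flat W)) /\
  ohead (proj a b (flat (expand W))) = ohead (proj a b (flat W)).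
Proof.
move=> ab; elim: W => [|[[] B] W IH] //=; last first.
  move=> /andP[_ bW] uW; have [e e'] := IH bW uW.
  rewrite !flat_cons !proj_cat.
  split; last by case: (proj a b B).
  by have := runs_cat_ohead (proj a b B) e'; lia.
move=> /andP[/andP[uB /eqP sB] bW] /andP[nB uW]; have [e e'] := IH bW uW.
rewrite flat_cat flat_cons !proj_cat.
have [aB|aB] := boolP (a \in B); have [bB|bB] := boolP (b \in B).
- by rewrite aB bB in nB.
- have bR : b \notin flat (relabel B) by rewrite mem_relabel.
  rewrite (proj_notin_r ab bB) (proj_notin_r ab bR) (count_uniq_mem a uB) aB.
  by apply: runs_nseq_cat; rewrite // -has_count has_pred1 mem_relabel.
- have aR : a \notin flat (relabel B) by rewrite mem_relabel.
  rewrite (proj_notin_l ab aB) (proj_notin_l ab aR) (count_uniq_mem b uB) bB.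
  by apply: runs_nseq_cat; rewrite // -has_count has_pred1 mem_relabel.
- by rewrite (proj_notin aB bB) proj_notin ?mem_relabel.
Qed.

Lemma expand_order a b W : block_sizes (nsym Z) W -> unshared a b W ->
  subseq [:: a; b] (flat (expand W)) -> subseq [:: a; b] (flat W).
Proof.
elim: W => [|[[] B] W IH] //=; last first.
  move=> /andP[_ bW] uW; rewrite !flat_cons !subseq2_cat mem_expand //.
  by case/or3P => [->|/(IH bW uW) ->|->]; rewrite ?orbT.
move=> /andP[/andP[uB /eqP sB] bW] /andP[nB uW].
rewrite flat_cat flat_cons !subseq2_cat mem_expand // mem_relabel //.
case/or3P => [/subseq2_mem[]|/(IH bW uW) ->|->]; rewrite ?orbT //.
by rewrite !mem_relabel // => aB bB; rewrite aB bB in nB.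
Qed.

Lemma unshared_split a b W : ~~ unshared a b W -> exists W1 B W2,
  [/\ W = W1 ++ (true, B) :: W2, unshared a b W1, a \in B & b \in B].
Proof.
elim: W => //= -[p B] W IH; rewrite /=.
case: p => /= [|/IH[W1 [C [W2 [-> uW1 aC bC]]]]]; last first.
  by exists ((false, B) :: W1), C, W2.
case: (boolP ((a \in B) && (b \in B))) => [/andP[aB bB] _|nB].
  by exists [::], B, W.
case/IH => [W1 [C [W2 [-> uW1 aC bC]]]].
by exists ((true, B) :: W1), C, W2; split=> //=; rewrite nB.
Qed.

(** If a later special block [C] had both symbols, the order [a], [b] in [C] would violate the
    condition of [B] on what follows it, and the order [b], [a] the condition of [C] on what
    precedes it. *)
Lemma nest_unshared a b U B W : nest U ((true, B) :: W) [::] ->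
  all (fun p => uniq p.2) W -> a != b -> subseq [:: a; b] B -> unshared a b W.
Proof.
move=> /= [/(_ isT) nB nW] uW ab abB; apply/negPn/negP => /unshared_split.
move=> [W1 [C [W2 [WE _ aC bC]]]]; rewrite WE all_cat /= in uW.
have uC : uniq C by case/and3P: uW.
have [_] := nB a b abB; rewrite cats0 WE flat_cat flat_cons !subseq2_cat !negb_or.
case/and3P => _ /and3P[abC _ _] _; case/orP: (uniq_subseq2 uC ab aC bC) => baC.
  by rewrite baC in abC.
move: nW; rewrite WE => /nest_cat[_ /= [/(_ isT b a baC)[+ _] _]].
by rewrite !subseq2_cat abB !orbT.
Qed.

Variables (s : nat) (l : bool).

Hypothesis Z_runs : forall x y, x != y -> subseq [:: x; y] (undup (flat Z)) ->
  forall u v, ~~ subseq [:: false; true] u -> ~~ subseq [:: true; false] v ->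
  (l -> v = [::]) -> runs (u ++ proj x y (flat Z) ++ v) <= s.+1.

(** [B] is the only special block with both symbols. By nestedness the word before it reads a..ab..b
    and the word after it b..ba..a, so these are the [u] and [v] of [Z_runs]. *)
Lemma runs_expand_shared a b W1 B W2 :
  let W := W1 ++ (true, B) :: W2 in
  block_sizes (nsym Z) W -> nest [::] W [::] -> (l -> lasts W [::]) ->
  unshared a b W1 -> a != b -> subseq [:: a; b] B ->
  runs (proj a b (flat (expand W))) <= s.+1.
Proof.
move=> W bW nW lW uW1 ab abB.
have [bW1 [uB sB] bW2] : [/\ block_sizes (nsym Z) W1, uniq B /\ size B = nsym Z &
    block_sizes (nsym Z) W2].
  by move: bW; rewrite /block_sizes all_cat /= => /and3P[-> /andP[-> /eqP ->] ->].
have uW2 : unshared a b W2.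
  apply: nest_unshared ab abB; first by case/nest_cat: nW => _; exact.
  by case/block_sizesP: bW2.
have -> : expand W = expand W1 ++ relabel B ++ expand W2.
  by rewrite /W; elim: (W1) => [|[[] C] V IH] //=; rewrite IH ?catA.
rewrite !flat_cat !proj_cat.
case/nest_cat: nW => _ [/(_ isT a b abB)[nW1 nW2] _].
rewrite cats0 in nW2; rewrite /= in nW1.
have [h [hi hB ->]] := relabelE uB sB.
have : exists x y, [/\ x \in flat Z, y \in flat Z, a = h x & b = h y].
  have [] := subseq2_mem abB; rewrite -hB => /mapP[x xZ ->] /mapP[y yZ ->].
  by exists x, y; rewrite -!(mem_undup (flat Z)).
case=> x [y [xZ yZ aE bE]].
rewrite {2}/flat symb_map aE bE (proj_map_in hi) // -aE -bE.
apply: Z_runs.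
- by apply: contra ab => /eqP xy; rewrite aE bE xy.
- move: abB; rewrite -hB aE bE (subseq2_map_in hi) //.
  by move=> z; rewrite mem_undup.
- rewrite (subseq_proj _ false ab); apply: contra nW1; apply: expand_order => //.
  by rewrite unsharedC.
- by rewrite (subseq_proj _ true ab); apply: contra nW2; apply: expand_order.
move=> lT; have [_ [/(_ isT) lB _]] := (lasts_cat _ _ _).1 (lW lT).
rewrite cats0 in lB; have [aB bB] := subseq2_mem abB.
by apply: proj_notin; rewrite mem_expand // lB.
Qed.

Lemma prelayout_expand m N cs cn csZ cnZ W : N = nsym Z ->
  layout s l N cs cn W -> block_sizes m Z -> (l -> lasts Z [::]) ->
  (forall x, x \in flat Z -> count_mem x (symb id Z) = csZ /\
                            count_mem x (symb negb Z) = cnZ) ->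
  prelayout s l m (cs * csZ) (cn + cs * cnZ) (expand W).
Proof.
move=> -> [[bW rW lW cW] nW] bZ lZ cZ; split.
- exact: block_sizes_expand.
- move=> a b ab; have [uab|] := boolP (unshared a b W).
    by have [-> _] := runs_expand_unshared ab bW uab; exact: rW.
  case/unshared_split => [W1 [B [W2 [WE uW1 aB bB]]]].
  have uB : uniq B.
    by move: bW; rewrite WE /block_sizes all_cat /= => /and3P[_ /andP[]].
  case/orP: (uniq_subseq2 uB ab aB bB) => oB; rewrite WE in bW nW lW *.
    exact: runs_expand_shared.
  rewrite -runs_projC //; apply: runs_expand_shared => //.
    by rewrite unsharedC.
  by rewrite eq_sym.
- by move=> lT; apply: lasts_expand => //; [exact: lZ|exact: lW].
move=> x; rewrite mem_expand // => /cW[cs1 cn1].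
rewrite (@count_expand id csZ) // ?(@count_expand negb cnZ) // ?cs1 ?cn1 ?mul1n //.
  by move=> z /cZ[].
by move=> z /cZ[].
Qed.

End Expand.

(** * The recursive families *)

(* The inverse of alphad e.+1: ack e m is the largest x with alphad e.+1 x <= m. *)
Fixpoint ack e m := if e is e'.+1 then iter m (ack e') 1 else 2 * m.

(** * Growth of the hierarchy [ack] *)

Lemma exp2_le_ack e m : 2 ^ m <= ack e.+1 m /\ m.+1 <= ack e.+1 m.
Proof.
have ltn_exp n : n.+1 <= 2 ^ n by apply: ltn_expl.
suff H : 2 ^ m <= ack e.+1 m by split=> //; apply: leq_trans H.
elim: e m => [|e IH] m.
  elim: m => // m IHm; rewrite expnS.
  have -> : ack 1 m.+1 = 2 * ack 1 m by [].
  by rewrite leq_mul2l.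
elim: m => // m IHm; have -> : ack e.+2 m.+1 = ack e.+1 (ack e.+2 m) by [].
apply: leq_trans (IH _); rewrite leq_exp2l //.
by apply: leq_trans IHm.
Qed.

Lemma leq_ack e m : m <= ack e m.
Proof.
case: e => [|e]; first by rewrite /= leq_pmull.
by apply: ltnW; case: (exp2_le_ack e m).
Qed.

Lemma ack_mono e m n : m <= n -> ack e m <= ack e n.
Proof.
case: e => [|e] mn; first by rewrite /= leq_mul2l mn orbT.
elim: n mn => [|n IH]; first by rewrite leqn0 => /eqP ->.
rewrite leq_eqVlt => /orP[/eqP -> //|]; rewrite ltnS => /IH h.
by apply: leq_trans h _; exact: leq_ack.
Qed.

Lemma iter_ack_mono e n x y : x <= y -> iter n (ack e) x <= iter n (ack e) y.
Proof. by move=> xy; elim: n => //= n IH; apply: ack_mono. Qed.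

Lemma iter_ack_ge e n x : x <= iter n (ack e) x.
Proof. by elim: n => //= n IH; apply: leq_trans (leq_ack _ _). Qed.

Lemma sqr_le_ack e y : 4 <= y -> y * y <= ack e.+1 y.
Proof.
move=> y4; apply: leq_trans (proj1 (exp2_le_ack e y)).
rewrite -(subnK y4); elim: (y - 4) => // n IH; rewrite addSn expnS; nia.
Qed.

Lemma cube_le_ack e y : 16 <= y -> y * y * y <= ack e.+1 y.
Proof.
move=> y4; apply: leq_trans (proj1 (exp2_le_ack e y)).
rewrite -(subnK y4); elim: (y - 16) => [|n IH]; last by rewrite addSn expnS; nia.
by rewrite add0n; lia.
Qed.

(** Bounds the number of special blocks. Six applications per unit of [m] pay for one recursion
    step, and the start 16 keeps arguments in the range of [cube_le_ack]. *)
Definition bound k m := iter (6 * m) (ack k.+1) 16.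

Lemma bound_ack k m : bound k m <= ack k.+2 (6 * m + 16).
Proof. by rewrite /= iterD; apply: iter_ack_mono; apply: (leq_ack k.+2). Qed.

Lemma bound_le k z y : 16 <= y -> z <= y -> bound k z <= ack k.+2 (ack k.+2 y).
Proof.
move=> y16 zy; apply: leq_trans (bound_ack k z) _; apply: ack_mono.
by have := sqr_le_ack k.+1 (y := y); nia.
Qed.

Lemma bound_ge k m : 16 <= bound k m.
Proof. exact: iter_ack_ge. Qed.

(** [f], [g], [S] count the special blocks of the fused, the expanding and the expanded word, and
    [N] the symbols of the expanding one. In terms of [F] and [x], [g] costs two applications of
    [F], [N] three and [S] five; a sixth absorbs the product of three factors. *)
Lemma boundS k m f g N S : f <= bound k.+1 m -> g <= bound k f -> N <= g * f ->
  S <= bound k N -> S * g * f <= bound k.+1 m.+1.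
Proof.
set x := bound k.+1 m => fx gf Nf SN; set F := ack k.+2.
have x16 : 16 <= x := bound_ge _ _.
have Fge y : y <= F y := leq_ack _ _.
have gF : g <= F (F x) by apply: leq_trans gf _; apply: bound_le.
have F2 : 16 <= F (F x) by apply: leq_trans x16 _; apply: leq_trans (Fge x) _.
have NF : N <= F (F (F x)).
  apply: leq_trans Nf _; apply: leq_trans (sqr_le_ack k.+1 _); last exact: leq_trans F2.
  apply: leq_mul => //; apply: leq_trans fx _; exact: leq_trans (Fge x) (Fge _).
have SF : S <= F (F (F (F (F x)))).
  by apply: leq_trans SN _; apply: bound_le => //; apply: leq_trans F2 _.
have -> : bound k.+1 m.+1 = F (F (F (F (F (F x))))).
  by rewrite /bound mulnS.
apply: leq_trans (cube_le_ack k.+1 _); last first.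
  by apply: leq_trans F2 _; do 3 ![apply: leq_trans (Fge _) _].
have FF : F (F x) <= F (F (F (F (F x)))).
  by do 2 ![apply: leq_trans (Fge _)].
apply: leq_mul; first by apply: leq_mul => //; apply: leq_trans FF.
by apply: leq_trans FF; apply: leq_trans fx _; apply: leq_trans (Fge x) _.
Qed.

(** One step of the double recursion: [W1] is the word of the lower level, [Z] expands its special
    blocks, and [W2] is the word with shorter special blocks whose copies receive the result. *)
Lemma layout_step (T0 T1 T2 : eqType) s (l : bool) m cs cn csZ cnZ
    (Z : blocks T0) (W1 : blocks T1) (W2 : blocks T2) :
  4 <= s + l -> 0 < nsym Z -> block_sizes (nblocks id W2) Z ->
  (forall x y, x != y -> subseq [:: x; y] (undup (flat Z)) ->
    forall u v, ~~ subseq [:: false; true] u -> ~~ subseq [:: true; false] v ->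
    (l -> v = [::]) -> runs (u ++ proj x y (flat Z) ++ v) <= s.+1) ->
  (l -> lasts Z [::]) ->
  (forall x, x \in flat Z -> count_mem x (symb id Z) = csZ /\
                            count_mem x (symb negb Z) = cnZ) ->
  layout s l (nsym Z) cs cn W1 ->
  layout s l m (cs * csZ) (cn + cs * cnZ) W2 ->
  exists (T : eqType) (W : blocks T),
    [/\ layout s l m.+1 (cs * csZ) (cn + cs * cnZ) W,
        nblocks id W = nblocks id W1 * nblocks id Z * nblocks id W2 &
        nblocks negb W = nblocks negb W1 + nblocks id W1 * nblocks negb Z +
                         nblocks id W1 * nblocks id Z * nblocks negb W2].
Proof.
move=> sl Z0 bZ rZ lZ cZ L1 L2.
have := prelayout_expand Z0 rZ erefl L1 bZ lZ cZ => L3.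
exists (T1 + nat * T2)%type, (fuse 0 (expand Z W1) W2); split.
- exact: layout_fuse.
- rewrite nblocks_fuse !(nblocks_expand Z0) ?mul0n ?add0n //; by case: L1 => -[].
- rewrite nblocks_fuse !(nblocks_expand Z0) ?mul0n ?mul1n ?add0n //; by case: L1 => -[].
Qed.

Definition base m : blocks nat := [:: (true, iota 0 m); (true, iota m m)].

Lemma flat_base m : flat (base m) = iota 0 (m + m).
Proof. by rewrite iotaD /flat /symb /= cats0. Qed.

(** For [m = 0] there are no symbols and any occurrence counts hold, which starts the recursion on
    [m] at every level. *)
Lemma layout_base s l m cs cn : 0 < s -> m = 0 \/ (cs = 1 /\ cn = 0) ->
  layout s l m cs cn (base m).
Proof.
move=> s0 mc; have uB : uniq (flat (base m)) by rewrite flat_base iota_uniq.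
split; last by apply: nest_uniq; rewrite cats0.
split.
- by rewrite /block_sizes /= !iota_uniq !size_iota !eqxx.
- by move=> a b ab; apply: leq_trans (runs_uniq ab uB) _.
- by move=> _; apply: lasts_uniq; rewrite cats0.
move=> x xB; case: mc xB => [->//|[-> ->] xB]; split => //.
have -> : symb id (base m) = flat (base m) by [].
by rewrite count_uniq_mem // xB.
Qed.

(* What replaces a special block: both copies are special for order 4, and only
   the second one, made of last occurrences, for order 3. *)
Definition hat p N : blocks nat := [:: (p, rev (iota 0 N)); (true, iota 0 N)].

Lemma flat_hat p N : flat (hat p N) = rev (iota 0 N) ++ iota 0 N.
Proof. by rewrite /flat /symb /= cats0. Qed.

Lemma undup_hat p N : undup (flat (hat p N)) = iota 0 N.
Proof.
rewrite flat_hat; have : {subset rev (iota 0 N) <= iota 0 N}.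
  by move=> x; rewrite mem_rev.
elim: (rev _) => [|x w IH] sub /=; first by rewrite undup_id ?iota_uniq.
rewrite mem_cat sub ?mem_head ?orbT // IH // => y yw.
by apply: sub; rewrite inE yw orbT.
Qed.

Lemma nsym_hat p N : nsym (hat p N) = N.
Proof. by rewrite /nsym undup_hat size_iota. Qed.

Lemma hat_sizes p N : block_sizes N (hat p N).
Proof.
by rewrite /block_sizes /= rev_uniq !iota_uniq size_rev !size_iota !eqxx implybT.
Qed.

Lemma lasts_hat N : lasts (hat false N) [::].
Proof.
by split=> //; apply: lasts_uniq; rewrite cats0 /flat /symb /= cats0 iota_uniq.
Qed.

Lemma count_hat p N x : x \in flat (hat p N) ->
  count_mem x (symb id (hat p N)) = p.+1 /\
  count_mem x (symb negb (hat p N)) = ~~ p.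
Proof.
rewrite flat_hat mem_cat mem_rev orbb => xN.
by case: p; rewrite /symb /= cats0 ?count_cat ?count_rev
  !count_uniq_mem ?iota_uniq ?xN // rev_uniq iota_uniq.
Qed.

Lemma proj_hat p N x y : x != y -> subseq [:: x; y] (undup (flat (hat p N))) ->
  proj x y (flat (hat p N)) = [:: false; true; true; false].
Proof.
rewrite undup_hat flat_hat => xy xyN.
have pE : proj x y (iota 0 N) = [:: true; false].
  have [xN yN] := subseq2_mem xyN.
  have := subseq_proj (iota 0 N) true xy; rewrite xyN => /size_subseq_leqif.
  case=> _ /=; rewrite size_proj // !count_uniq_mem ?iota_uniq // xN yN.
  by move=> /esym/eqP ->.
by rewrite proj_cat pE /proj filter_rev map_rev -/(proj x y _) pE.
Qed.

(* Parity: if the middle part, which ends with b, starts with a, it has an even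
   number of runs, hence at most s - 2, which pays for the two runs of u. *)
Lemma runs_sandwich s r u v : ~~ odd s -> runs (rcons r false) <= s.-1 ->
  ~~ subseq [:: false; true] u -> ~~ subseq [:: true; false] v ->
  runs (u ++ rcons r false ++ v) <= s.+1.
Proof.
move=> s2 rr nu nv; have rv := runs_cat_rising r nv.
have := runs_falling (rcons r false ++ v) nu.
have ev : ohead (rcons r false ++ v) != Some false -> ~~ odd (runs (rcons r false)).
  by case: r {rr rv} => [|[] r] // _; rewrite rcons_cons odd_runs last_rcons.
have r1 : 0 < runs (rcons r false).
  by rewrite -cats1; apply: (runs_cat_mono r [:: false]).
have le1 (b : bool) : b <= 1 by case: b.
have := le1 (ohead (u ++ rcons r false ++ v) == Some true).
by case: (boolP (ohead _ != _)) => [/ev|_] /=; lia.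
Qed.

(** [undup] keeps last occurrences, so [x] before [y] there means that the projection ends with
    [y]. *)
Lemma proj_last (T : eqType) (x y : T) w : x != y ->
  subseq [:: x; y] (undup w) -> exists r, proj x y w = rcons r false.
Proof.
move=> xy; elim: w => //= z w IH.
have ext : (exists r, proj x y w = rcons r false) ->
    exists r, proj x y (z :: w) = rcons r false.
  case=> r rE; exists (proj x y [:: z] ++ r).
  by rewrite rcons_cat -rE -proj_cat.
case: (boolP (z \in w)) => zw; first by move=> /IH /ext.
rewrite /=; case: eqP => [xz|_]; last by move=> /IH /ext.
rewrite sub1seq mem_undup => yw; apply: ext.
rewrite proj_notin_l // ?xz //; move: yw; rewrite -has_pred1 has_count.
case: (count _ _) => // n _; exists (nseq n false).
by elim: n => //= n <-.
Qed.

(* Nonspecial blocks number at most (k + 1)^2 times the special ones; the extra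
   additive term is what makes the induction go through. *)
Definition family3 k m := exists (T : eqType) (W : blocks T),
  [/\ layout 3 true m 1 k W, 2 <= nblocks id W <= bound k m &
      nblocks negb W + 2 * (k ^ 2 + 1) <= k.+1 ^ 2 * nblocks id W].

Lemma family3_holds k m : family3 k m.
Proof.
elim: k m => [|k IHk] m.
  exists nat, (base m); split; first by apply: layout_base => //; right.
    by rewrite /=; have := bound_ge 0 m; lia.
  by rewrite /=.
elim: m => [|m [T2 [W2 [L2 S2 R2]]]].
  exists nat, (base 0); split; first by apply: layout_base => //; left.
    by rewrite /=; have := bound_ge k.+1 0; lia.
  by rewrite /= !expnS expn0; nia.
set f := nblocks id W2 in S2 R2 *.
have [T1 [W1 [L1 S1 R1]]] := IHk f.
have [] := @layout_step _ _ _ 3 true m 1 k 1 1 (hat false f) W1 W2.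
- by [].
- by rewrite nsym_hat; case/andP: S2 => /ltnW.
- exact: hat_sizes.
(* The hat reads b a a b and nothing follows it; as it starts with b, the part before it adds only a
   run of a. *)
- move=> x y xy /(proj_hat xy) -> u v nu nv /(_ isT) ->.
  apply: leq_trans (runs_falling _ nu) _ => /=; by case: (_ == _).
- by move=> _; exact: lasts_hat.
- exact: count_hat.
- by rewrite nsym_hat.
- by rewrite mul1n addn1.
rewrite mul1n addn1 => T [W [L SE RE]]; exists T, W; split => //; rewrite SE -/f.
  rewrite /= muln1; case/andP: S1 S2 => S1 S1' /andP[S2 S2'].
  apply/andP; split; first by nia.
  have := @boundS k m f 1 f (nblocks id W1) S2'; rewrite muln1.
  apply => //; last by rewrite mul1n.
  by apply: leq_trans (bound_ge k f).
rewrite RE -/f /= !muln1; case/andP: S1 => S1 _.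
set P := k.+1 ^ 2 in R1 R2 *; set Q := k.+2 ^ 2 in R2 *.
(* Multiplied by [g], the additive term gives [(P + 1) * g] twice: once for the nonspecial blocks of
   [W1] and the [g] new ones, once, since [g >= 2], for the new additive term. *)
have h1 := leq_mul (leqnn (nblocks id W1)) R2.
have h2 := leq_mul S1 (leqnn (P + 1)).
set g := nblocks id W1 in h1 h2 R1 *.
rewrite (_ : Q * (g * f) = g * (Q * f)); last by rewrite mulnCA.
have e1 : g * (nblocks negb W2 + 2 * (P + 1)) =
    g * nblocks negb W2 + 2 * (P * g) + 2 * g.
  by rewrite mulnDr [g * (2 * _)]mulnCA [g * (P + 1)]mulnC mulnDl mul1n mulnDr addnA.
have e2 : g * (P + 1) = P * g + g by rewrite mulnC mulnDl mul1n.
move: h1 h2 R1; rewrite e1 e2.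
by move: (g * (Q * f)) (P * g) (g * nblocks negb W2) => x y z; lia.
Qed.

Definition family_even t k m := exists (T : eqType) (W : blocks T),
  [/\ layout (2 * t + 2) false m (2 ^ 'C(k, t)) 0 W, nblocks negb W = 0 &
      2 <= nblocks id W <= bound k m].

(** For [t = 1] special blocks are expanded by hats, which doubles the occurrences at each level.
    For larger [t] they are expanded by the family of [t - 1], and the exponents add up by Pascal's
    rule. *)
Lemma family_even_holds t k m : 0 < t -> family_even t k m.
Proof.
case: t => // t _; elim: t k m => [|t IHt] k; elim: k => [|k IHk] m.
- exists nat, (base m); split=> //; first by apply: layout_base => //; right.
  by rewrite /=; have := bound_ge 0 m; lia.
- elim: m => [|m [T2 [W2 [L2 R2 S2]]]].
    by exists nat, (base 0); split.
  set f := nblocks id W2 in S2 *.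
  have [T1 [W1 [L1 R1 S1]]] := IHk f.
  have [] := @layout_step _ _ _ 4 false m (2 ^ 'C(k, 1)) 0 2 0 (hat true f) W1 W2.
  + by [].
  + by rewrite nsym_hat; case/andP: S2 => /ltnW.
  + exact: hat_sizes.
  + move=> x y xy /(proj_hat xy) -> u v nu nv _.
    exact: (@runs_sandwich 4 [:: false; true; true]).
  + by [].
  + exact: count_hat.
  + by rewrite nsym_hat.
  + by move: L2; rewrite !bin1 expnSr muln0 addn0.
  rewrite muln0 addn0 -expnSr => T [W [L SE RE]].
  exists T, W; split => //; first by move: L; rewrite !bin1.
    by rewrite RE R1 R2 /=; lia.
  rewrite SE -/f /=; case/andP: S1 S2 => S1 S1' /andP[S2 S2'].
  apply/andP; split; first by nia.
  apply: (@boundS k m f 2 f (nblocks id W1)) => //; last by rewrite leq_pmull.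
  by apply: leq_trans (bound_ge k f).
- exists nat, (base m); split=> //; first by apply: layout_base; [lia|right].
  by rewrite /=; have := bound_ge 0 m; lia.
elim: m => [|m [T2 [W2 [L2 R2 S2]]]].
  by exists nat, (base 0); split.
set f := nblocks id W2 in S2 *.
have [T0 [Z [[[bZ rZ _ cZ] _] RZ SZ]]] := IHt k f.
have nZ : nsym Z * 2 ^ 'C(k, t.+1) = nblocks id Z * f.
  by apply: nsym_special bZ _ => x /cZ[].
have Z0 : 0 < nsym Z by case: (nsym Z) nZ => //; nia.
have [T1 [W1 [L1 R1 S1]]] := IHk (nsym Z).
have [] := @layout_step _ _ _ (2 * t.+2 + 2) false m (2 ^ 'C(k, t.+2)) 0
  (2 ^ 'C(k, t.+1)) 0 Z W1 W2.
+ by lia.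
+ by [].
+ by [].
+ move=> x y xy xyZ u v nu nv _; have [r rE] := proj_last xy xyZ.
  rewrite rE; apply: runs_sandwich => //; first by lia.
  by rewrite -rE; apply: leq_trans (rZ _ _ xy) _; lia.
+ by [].
+ exact: cZ.
+ exact: L1.
+ by rewrite muln0 addn0 -expnD -binS.
rewrite muln0 addn0 -expnD -binS => T [W [L SE RE]].
exists T, W; split => //; first by rewrite RE R1 R2 RZ; lia.
rewrite SE -/f; case/andP: S1 S2 SZ => S1 S1' /andP[S2 S2'] /andP[SZ SZ'].
apply/andP; split; first by nia.
apply: (@boundS k m f _ (nsym Z)) => //.
by have := expn_gt0 2 'C(k, t.+1); nia.
Qed.

(** * Shattering and VC-dimension *)

Lemma prefix_cover (T : eqType) (A w : seq T) : A != [::] -> {subset A <= w} ->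
  exists p z w', [/\ w = p ++ z :: w', z \in A, z \notin p & {subset A <= rcons p z}].
Proof.
elim: w A => [|c w IH] A A0 Aw.
  by case: A A0 Aw => // a A _ /(_ a (mem_head _ _)).
have [A1|A1] := eqVneq [seq x <- A | x != c] [::].
  have Ac x : x \in A -> x = c.
    move=> xA; apply/eqP/negPn/negP => xc.
    have : x \in [seq x <- A | x != c] by rewrite mem_filter xc.
    by rewrite A1.
  exists [::], c, w; split=> //=; last by move=> x /Ac ->; rewrite inE.
  by case: A A0 Ac {Aw A1} => // a A _ Ac; rewrite -(Ac a (mem_head _ _)) mem_head.
have [|p [z [w' [-> zA zp Ap]]]] := IH _ A1.
  by move=> x; rewrite mem_filter => /andP[xc /Aw]; rewrite inE (negbTE xc).
move: zA; rewrite mem_filter => /andP[zc zA].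
exists (c :: p), z, w'; split=> //; first by rewrite inE negb_or zc.
move=> x xA; rewrite rcons_cons inE; case: eqP => //= /eqP xc.
by apply: Ap; rewrite mem_filter xc.
Qed.

(* Let z be the symbol of A completing the shortest prefix that contains A: all
   orders starting with z force the rest of the word to contain all orders of
   A minus z, and the prefix adds one run to every pair. *)
Lemma shatter_runs (T : eqType) (A w : seq T) : uniq A -> 1 < size A ->
  (forall l, perm_eq l A -> subseq l w) ->
  exists x y, [/\ x \in A, y \in A, x != y & size A < runs (proj x y w)].
Proof.
move: {2}(size A) (leqnn (size A)) => n; elim: n A w => [|n IH] A w; first by case: A.
move=> An uA A1 Aw.
have A0 : A != [::] by case: A A1 {An uA Aw}.
have sAw : {subset A <= w} by apply: mem_subseq; apply: Aw.
have [p [z [w' [wE zA zp Ap]]]] := prefix_cover A0 sAw.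
set A' := rem z A.
have sA' : (size A').+1 = size A by rewrite size_rem // prednK // (ltnW A1).
have zA' : z \notin A' by rewrite mem_rem_uniq // inE eqxx.
have A'A x : x \in A' -> x \in A by move/mem_rem.
have Aw' l : perm_eq l A' -> subseq l w'.
  move=> lA'; have : subseq (z :: l) w.
    apply: Aw; rewrite perm_sym; apply: perm_trans (perm_to_rem zA) _.
    by rewrite perm_cons perm_sym.
  rewrite wE; elim: p zp {Ap wE} => [|c p IHp] /=; first by rewrite eqxx.
  by rewrite inE negb_or => /andP[/negbTE -> /IHp].
have both x y u : x \in rcons p z -> y \in rcons p z -> x != y ->
    runs (proj x y u) < runs (proj x y (rcons p z ++ u)).
  move=> xp yp xy; rewrite proj_cat.
  (* Both letters occur in the prefix, and [b] is one that does not start the rest. *)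
  pose b := ohead (proj x y u) != Some true.
  apply: (@runs_cat_new b); last by rewrite /b; case: (ohead _) => [[]|].
  by rewrite mem_proj //; case: (b).
have wE' : w = rcons p z ++ w' by rewrite wE cat_rcons.
have [A'1|A'1] := ltnP 1 (size A').
  have [|x [y [xA yA xy xyr]]] := IH A' w' _ (rem_uniq z uA) A'1 Aw'.
    by rewrite -ltnS sA'.
  exists x, y; split; rewrite ?A'A // wE' -sA'.
  by apply: leq_ltn_trans xyr (both _ _ _ _ _ _) => //; apply/Ap/A'A.
have sA'1 : size A' = 1 by lia.
case EA: A' sA'1 => [|x []] // _.
have xA' : x \in A' by rewrite EA mem_head.
have xA := A'A _ xA'; have zx : z != x by apply: contra zA' => /eqP ->.
have xw' : x \in w' by rewrite -sub1seq; apply: Aw'; rewrite EA.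
(* With two symbols, [x] occurs in [p] and again in [w'], with [z] in between. *)
exists x, z; split; rewrite 1?eq_sym // wE' -sA' EA /= cat_rcons proj_cat.
have xp : x \in p by have := Ap _ xA; rewrite mem_rcons inE eq_sym (negbTE zx).
have xz : x != z by rewrite eq_sym.
have -> : proj x z (z :: w') = false :: proj x z w'.
  by rewrite /proj /= eqxx orbT /= (negbTE zx).
have tp : true \in proj x z p by rewrite mem_proj.
have tw : true \in proj x z w' by rewrite mem_proj.
apply: leq_ltn_trans (@runs_cat_new true _ (false :: proj x z w') tp isT).
case/splitPr: tw => p1 p2.
apply: leq_ltn_trans (@runs_cat_new false (false :: p1) (true :: p2) _ _) => //.
by have := @runs_cat_new true (true :: p2) [::] (mem_head _ _) isT; rewrite cats0.
Qed.

Section VC.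
Variable n : nat.
Implicit Types (P Q : {set 'S_n}) (pi : 'S_n).

Lemma VCdim_leP P k :
  (forall j (a : j.-tuple 'I_n), k < j -> is_position_tuple a -> ~~ shattered P a) ->
  VCdim P <= k.
Proof.
move=> h; apply/bigmax_leqP => j /existsP[a /andP[pa sa]].
by rewrite leqNgt; apply/negP => kj; have := h _ a kj pa; rewrite sa.
Qed.

Lemma VCdim_ge P k (a : k.-tuple 'I_n) : is_position_tuple a -> shattered P a ->
  k <= VCdim P.
Proof.
move=> pa sa; have kn : k < n.+1.
  have ua : uniq a.
    apply: (sorted_uniq (leT := fun i j : 'I_n => i < j)) pa => [x y z|x].
      exact: ltn_trans.
    by rewrite ltnn.
  by rewrite ltnS -(size_tuple a) -(card_uniqP ua) -[X in _ <= X]card_ord max_card.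
apply: (leq_bigmax_cond (Ordinal kn)); apply/existsP; exists a; exact/andP.
Qed.

Lemma VCdim_setT : n <= VCdim [set: 'S_n].
Proof.
apply: (@VCdim_ge _ n (ord_tuple n)).
  have : sorted ltn (map val (ord_tuple n)).
    by rewrite val_ord_tuple val_enum_ord iota_ltn_sorted.
  by rewrite sorted_map.
apply/forallP => s; apply/existsP; exists s; rewrite inE /=.
by apply/forallP => i; apply/forallP => j; rewrite !tnth_ord_tuple.
Qed.

(* A pattern on k positions extends to two patterns on k + 1 positions, and the
   single permutation pi realizes at most one of them. *)
Lemma VCdim_setU1 P pi : VCdim (pi |: P) <= (VCdim P).+1.
Proof.
apply: VCdim_leP => -[|[|k]] a //; rewrite ltnS => Pk pa; apply/negP => sa.
move: Pk; rewrite ltnNge => /negP; apply.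
pose b := [tuple of behead a].
have ab i : tnth b i = tnth a (lift ord0 i).
  by rewrite tnth_behead; congr tnth; apply: val_inj; rewrite /= inordK // ltnS.
apply: (@VCdim_ge _ _ b).
  by move: pa; rewrite /is_position_tuple /=; case: (tval a) => //= x s /path_sorted.
apply/forallP => s; apply/existsP.
have restr j rho : is_restriction rho a (lift_perm ord0 j s) -> is_restriction rho b s.
  move=> /forallP h; apply/forallP => x; apply/forallP => y.
  have /forallP/(_ (lift ord0 y)) := h (lift ord0 x).
  by rewrite !lift_perm_lift -!ab /= /bump => /eqP <-; apply/eqP; lia.
have /forallP/(_ (lift_perm ord0 ord0 s))/existsP[r0 /andP[r0P r0s]] := sa.
have /forallP/(_ (lift_perm ord0 ord_max s))/existsP[r1 /andP[r1P r1s]] := sa.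
move: r0P r1P; rewrite !inE => /orP[/eqP r0E|r0P] => [|_]; last first.
  by exists r0; rewrite r0P (restr _ _ r0s).
move=> /orP[/eqP r1E|r1P]; last by exists r1; rewrite r1P (restr _ _ r1s).
exfalso; move: r0s r1s; rewrite r0E r1E.
move=> /forallP/(_ ord0)/forallP/(_ (lift ord0 ord0))/eqP h0.
move=> /forallP/(_ ord0)/forallP/(_ (lift ord0 ord0))/eqP.
rewrite -h0 !lift_perm_id !lift_perm_lift /= /bump leq0n ltn0Sn.
have s0 : s ord0 <= k by rewrite -ltnS ltn_ord.
by rewrite [k < s ord0]ltnNge s0 add0n ltnNge (leqW s0).
Qed.

(** Permutations are added one by one up to the full set, of VC-dimension at least [n]; steps of at
    most 1 cannot skip [k]. *)
Lemma VCdim_extend P k : VCdim P <= k <= n ->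
  exists2 Q : {set 'S_n}, P \subset Q & VCdim Q = k.
Proof.
move: {2}#|~: P| (leqnn #|~: P|) => c; elim: c P => [|c IH] P cP /andP[Pk kn].
  have PT : P = setT.
    rewrite -[P]setCK; apply/setP => x; move: cP.
    by rewrite leqn0 cards_eq0 => /eqP ->; rewrite !inE.
  exists P => //; apply/eqP; rewrite eqn_leq Pk (leq_trans kn) // PT; exact: VCdim_setT.
have [<-|Pk'] := eqVneq (VCdim P) k; first by exists P.
have [pi piP] : exists pi, pi \notin P.
  apply/existsP; apply: contraT; rewrite negb_exists => /forallP PT.
  have PT' : P = setT by apply/setP => x; rewrite inE; apply/negPn.
  have := VCdim_setT; rewrite -PT'; lia.
have [|| Q sQ Qk] := IH (pi |: P).
- rewrite setCU setIC -setDE -ltnS; apply: leq_trans cP.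
  by rewrite [X in _ < X](cardsD1 pi) inE piP.
- by have := VCdim_setU1 P pi; lia.
by exists Q => //; apply: subset_trans sQ; apply: subsetUr.
Qed.

Lemma card_le_r P k : VCdim P <= k <= n -> #|P| <= r k n.
Proof.
case/VCdim_extend => Q PQ Qk; apply: leq_trans (subset_leq_card PQ) _.
by apply: (leq_bigmax_cond (F := fun P : {set 'S_n} => #|P|)); rewrite Qk.
Qed.

Lemma r_mono k : k < n -> r k n <= r k.+1 n.
Proof.
move=> kn; apply/bigmax_leqP => P /eqP Pk; apply: card_le_r; rewrite Pk; lia.
Qed.

End VC.

(** * Permutations listed by subsequences of a word *)

Section WordPerms.
Variable n : nat.
Implicit Types (pi : 'S_n) (w : seq 'I_n).

(** Positions by increasing value, so that a pattern is the order in which its positions are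
    listed. *)
Definition listing pi : seq 'I_n := [seq (pi^-1)%g i | i <- enum 'I_n].

Definition word_perms w : {set 'S_n} := [set pi | subseq (listing pi) w].

Lemma listing_sorted pi : sorted (fun i j => pi i < pi j) (listing pi).
Proof.
rewrite sorted_map; have : sorted ltn (map val (enum 'I_n)).
  by rewrite val_enum_ord iota_ltn_sorted.
rewrite sorted_map; apply: sub_sorted => i j /=.
by rewrite !permKV.
Qed.

Lemma mem_listing pi i : i \in listing pi.
Proof. by apply/mapP; exists (pi i); rewrite ?mem_enum // permK. Qed.

Lemma exists_listing (s : seq 'I_n) : perm_eq s (enum 'I_n) ->
  exists pi, listing pi = s.
Proof.
move=> sE; have sz : size s == n by rewrite (perm_size sE) size_enum_ord.
have inj : injective (tnth (Tuple sz)).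
  by apply/tuple_uniqP; rewrite /= (perm_uniq sE) enum_uniq.
exists (perm inj)^-1%g; rewrite /listing invgK -[RHS](map_tnth_enum (Tuple sz)).
by apply: eq_map => i; rewrite permE.
Qed.

(** If the positions [a] were shattered, every order of them would be a subsequence of [w], against
    [shatter_runs]. *)
Lemma VCdim_word_perms w k :
  (forall a b, a != b -> runs (proj a b w) <= k.+1) -> 0 < k ->
  VCdim (word_perms w) <= k.
Proof.
move=> rw k0; apply: VCdim_leP => j a kj pa; apply/negP => sa.
have ua : uniq a.
  apply: (sorted_uniq (leT := fun i j : 'I_n => i < j)) pa => [x y z|x].
    exact: ltn_trans.
  by rewrite ltnn.
have [||l la|x [y [xa ya xy]]] := @shatter_runs _ a w.
- by [].
- by rewrite size_tuple; lia.
- have ul : uniq l by rewrite (perm_uniq la).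
  have sl : size l = j by rewrite (perm_size la) size_tuple.
  have ltl i : index (tnth a i) l < j.
    by rewrite -[X in _ < X]sl index_mem (perm_mem la) mem_tnth.
  pose g i := Ordinal (ltl i).
  have g_inj : injective g.
    move=> i i' /(congr1 val) /= gii; apply/(tuple_uniqP _ ua).
    have il i0 : tnth a i0 \in l by rewrite (perm_mem la) mem_tnth.
    by rewrite -(nth_index (tnth a i) (il i)) gii nth_index.
  have /forallP/(_ (perm g_inj))/existsP[pi /andP[]] := sa.
  rewrite inE => piw /forallP pia; apply: subseq_trans piw.
  (* Both sides have the same elements and are sorted by the values of [pi]. *)
  suff -> : l = [seq x <- listing pi | x \in l] by apply: filter_subseq.
  pose lt (i j : 'I_n) := pi i < pi j.
  apply: (@irr_sorted_eq _ lt).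
  + by move=> x y z; apply: ltn_trans.
  + by move=> x; rewrite /lt ltnn.
  + apply: pairwise_sorted; case El: l => [//|x0 l0]; rewrite -El.
    apply/(pairwiseP x0) => i i'; rewrite !inE => il i'l ii'.
    have ind m : m < size l -> exists t, nth x0 l m = tnth a t /\ g t = m :> nat.
      move=> ml; have /tnthP[t tE] : nth x0 l m \in a by rewrite -(perm_mem la) mem_nth.
      by exists t; rewrite /= -tE index_uniq.
    have [t [tE gt]] := ind _ il; have [t' [t'E gt']] := ind _ i'l.
    have /forallP/(_ t')/eqP := pia t; rewrite !permE gt gt'.
    by rewrite /lt tE t'E => <-.
  + apply: sorted_filter; last exact: listing_sorted.
    by move=> x y z; apply: ltn_trans.
  + by move=> x; rewrite mem_filter mem_listing andbT.
by have := rw _ _ xy; rewrite size_tuple; lia.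
Qed.

Variables (M : nat) (Bs : seq (seq 'I_n)).
Hypotheses (Bs_uniq : all uniq Bs) (Bs_size : size Bs <= M.+1).

Implicit Types c : {ffun 'I_n -> 'I_M.+1}.

Let block (j : 'I_M.+1) := nth [::] Bs j.

Lemma count_blocks i : count_mem i (flatten Bs) = #|[pred j | i \in block j]|.
Proof.
rewrite count_flatten -sum1_card sumnE big_map.
rewrite (big_nth [::]) big_mkord.
rewrite [RHS]big_mkcond /=.
rewrite (big_ord_widen M.+1 (fun j => count_mem i (nth [::] Bs j))) //.
rewrite big_mkcond /=; apply: eq_bigr => j _; rewrite inE /block.
case: ltnP => jB; last by rewrite nth_default.
rewrite count_uniq_mem; last by apply: (allP Bs_uniq); rewrite mem_nth.
by case: (_ \in _).
Qed.

(** [c] assigns a block to every symbol; for [c] in [choices], keeping only the chosen occurrences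
    leaves every symbol exactly once. *)
Definition picked c : seq 'I_n :=
  flatten [seq [seq i <- block j | c i == j] | j <- enum 'I_M.+1].

Definition choices : {pred {ffun 'I_n -> 'I_M.+1}} :=
  family (fun i => [pred j | i \in block j]).

Lemma picked_subseq c : subseq (picked c) (flatten Bs).
Proof.
have -> : flatten Bs = flatten [seq block j | j <- enum 'I_M.+1].
  rewrite /block; have -> : [seq nth [::] Bs (nat_of_ord j) | j <- enum 'I_M.+1] =
      [seq nth [::] Bs j | j <- iota 0 M.+1].
    by rewrite -val_enum_ord -map_comp.
  rewrite -(subnKC Bs_size) iotaD map_cat flatten_cat -/(mkseq _ _) mkseq_nth.
  suff -> : flatten [seq nth [::] Bs i |
      i <- iota (0 + size Bs) (M.+1 - size Bs)] = [::].
    by rewrite cats0.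
  rewrite add0n; elim: (_ - _) {2 3}(size Bs) (leqnn (size Bs)) => //= d IH s sB.
  by rewrite nth_default // IH // leqW.
rewrite /picked; elim: (enum _) => //= j js IH.
by apply: cat_subseq => //; apply: filter_subseq.
Qed.

Lemma picked_perm c : c \in choices -> perm_eq (picked c) (enum 'I_n).
Proof.
move=> /familyP cF; have ct i : count_mem i (picked c) = 1.
  rewrite count_flatten sumnE big_map big_map big_enum /=.
  rewrite (bigD1 (c i)) //= big1 ?addn0 => [|j jc].
    rewrite count_filter -[RHS](_ : (i \in block (c i)) = 1 :> nat).
      rewrite -count_uniq_mem; last first.
        rewrite /block; case: (ltnP (c i) (size Bs)) => h; last by rewrite nth_default.
        by apply: (allP Bs_uniq); rewrite mem_nth.
      by apply: eq_count => x /=; case: eqP => // ->; rewrite eqxx.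
    by have := cF i; rewrite inE => ->.
  rewrite count_filter; apply/eqP; rewrite -leqn0 leqNgt -has_count.
  apply/hasPn => x _ /=; apply: contra jc => /andP[/eqP -> /eqP ->]; exact: eqxx.
apply/allP => i _ /=; rewrite ct count_uniq_mem ?enum_uniq // mem_enum.
by [].
Qed.

Lemma picked_sorted c : sorted leq [seq val (c i) | i <- picked c].
Proof.
rewrite sorted_pairwise; last exact: leq_trans.
rewrite /picked; have : sorted ltn (map val (enum 'I_M.+1)).
  by rewrite val_enum_ord iota_ltn_sorted.
rewrite sorted_map sorted_pairwise; last by move=> x y z; apply: ltn_trans.
elim: (enum _) => //= j js IH /andP[/allP jjs pjs].
rewrite map_cat pairwise_cat IH // andbT; apply/andP; split.
  apply/allrelP => _ _ /mapP[i ij ->] /mapP[i' i'js ->].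
  move: ij; rewrite mem_filter => /andP[/eqP -> _].
  case/flattenP: i'js => _ /mapP[j' j'js ->]; rewrite mem_filter => /andP[/eqP -> _].
  by apply/ltnW/jjs.
set s := filter _ _; have : all (fun i => c i == j) s by apply: filter_all.
elim: s => //= i s IHs /andP[/eqP ci cs]; rewrite IHs // andbT.
by rewrite all_map; apply: sub_all cs => x /eqP xj; rewrite /= ci xj.
Qed.

(* A choice of one block for every symbol is recovered from the permutation it
   induces together with the sorted sequence of the chosen blocks. *)
Lemma prod_count_le :
  \prod_(i < n) count_mem i (flatten Bs) <=
  #|word_perms (flatten Bs)| * 'C(n + M, M).
Proof.
have -> : \prod_(i < n) count_mem i (flatten Bs) = #|choices|.
  rewrite card_family foldrE big_map big_enum /=.
  by apply: eq_bigr => i _; exact: count_blocks.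
have -> : 'C(n + M, M) = #|[set t : n.-tuple 'I_M.+1 | sorted leq (map val t)]|.
  by rewrite card_sorted_tuples -[in RHS]bin_sub ?leq_addr // addKn.
rewrite -cardsX.
pose pp c := odflt 1%g [pick pi | listing pi == picked c].
have ppE c : c \in choices -> listing (pp c) = picked c.
  move=> /picked_perm/exists_listing[pi piE]; rewrite /pp.
  by case: pickP => [pi' /eqP //|/(_ pi)]; rewrite piE eqxx.
have szl pi : size (listing pi) == n by rewrite size_map size_enum_ord.
pose tp c := Tuple (szl (pp c)).
have tpE c : c \in choices -> tp c = picked c :> seq _ by move/ppE.
pose F c := (pp c, [tuple of map c (tp c)]).
rewrite -(card_in_imset (f := F)).
  apply: subset_leq_card; apply/subsetP => _ /imsetP[c cC ->].
  rewrite !inE /= ppE // picked_subseq /=.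
  by rewrite -map_comp; apply: picked_sorted.
move=> c c' cC c'C Fcc; apply/ffunP => i.
have /= ppc := congr1 fst Fcc; have /= mc := congr1 (fun x => val x.2) Fcc.
have pc : picked c = picked c' by rewrite -!ppE // ppc.
rewrite ppE // ppE // -pc in mc.
have ip : i \in picked c by rewrite (perm_mem (picked_perm cC)) mem_enum.
by move: mc => /eq_in_map; exact.
Qed.

End WordPerms.

(** * Lower bounds for r *)

Lemma word_lower_bound (T : eqType) (W : blocks T) (u : seq T) k M :
  all (fun p => uniq p.2) W -> size W <= M.+1 ->
  (forall a b, a != b -> runs (proj a b (flat W)) <= k.+1) ->
  uniq u -> {subset flat W <= u} -> 0 < k <= size u ->
  \prod_(x <- u) count_mem x (flat W) <= r k (size u) * 'C(size u + M, M).
Proof.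
move=> uW sW rW uu Wu /andP[k0 ku].
case E: u => [|x0 u0]; first by move: ku; rewrite E leqNgt k0.
rewrite -E; set n := size u.
have n0 : 0 < n by apply: leq_trans ku.
pose h x : 'I_n := insubd (Ordinal n0) (index x u).
have hE x : x \in u -> h x = index x u :> nat.
  by move=> xu; rewrite /h val_insubd index_mem xu.
have hi : {in u &, injective h}.
  move=> x y xu yu /(congr1 val) /=; rewrite !hE // => xy.
  by rewrite -(nth_index x0 xu) xy nth_index.
pose V := [seq (p.1, map h p.2) | p <- W].
have VE : flat V = map h (flat W) by exact: symb_map.
have -> : \prod_(x <- u) count_mem x (flat W) = \prod_(i < n) count_mem i (flat V).
  rewrite (big_nth x0) big_mkord; apply: eq_bigr => i _.
  have iu : nth x0 u i \in u by rewrite mem_nth.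
  have iE : h (nth x0 u i) = i by apply: val_inj; rewrite /= hE // index_uniq.
  by rewrite VE -[in RHS]iE (count_map_in hi).
have VB : flat V = flatten (map snd V) by rewrite /flat /symb filter_predT.
rewrite VB; have := @prod_count_le n M (map snd V).
have -> : all uniq [seq i.2 | i <- V].
  rewrite /V -map_comp all_map; apply/allP => -[p C] pC /=.
  rewrite map_inj_in_uniq; first exact: (allP uW _ pC).
  by move=> x y xC yC; apply: hi; apply/Wu/(mem_block pC).
rewrite !size_map => /(_ isT sW) H; apply: leq_trans H _.
rewrite leq_mul2r; apply/orP; right.
apply: card_le_r; rewrite ku andbT -VB VE; apply: VCdim_word_perms => // a b ab.
have [|aW] := boolP (a \in map h (flat W)); last first.
  by apply: leq_trans (runs_proj0 ab aW) _.
have [|bW] := boolP (b \in map h (flat W)); last first.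
  move=> _; rewrite -runs_projC //; apply: leq_trans (runs_proj0 _ bW) _ => //.
  by rewrite eq_sym.
move=> /mapP[y yW yE] /mapP[x xW xE]; subst a b.
rewrite (proj_map_in hi) ?Wu //; apply: rW.
by apply: contra ab => /eqP ->.
Qed.

(** Adapts [W] to a prescribed number of symbols: [q] disjoint copies and [t] fillers that occur
    once. *)
Lemma copies_lower_bound (T : eqType) (W : blocks T) s l m cs cn q t :
  layout s l m cs cn W -> 4 <= s + l -> s <= q * nsym W + t ->
  (cs + cn) ^ (q * nsym W) <=
    r s (q * nsym W + t) *
    'C(q * nsym W + t + q * size W, q * size W).
Proof.
move=> [[/block_sizesP[uW _] rW _ cW] _] sl sn.
have s0 : 0 < s by case: (l) sl; lia.
(* Fusing with empty special blocks just juxtaposes copies of [W]; the last block holds the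
   fillers. *)
pose W0 : blocks nat := nseq q (true, [::]) ++ [:: (false, iota 0 t)].
have flat0 : flat W0 = iota 0 t.
  rewrite flat_cat flat_cons cats0.
  by elim: q {sn W0}.
have nW0 : nblocks id W0 = q.
  by rewrite nblocks_cat /nblocks count_nseq /=; lia.
have fW0 : fits W0 W by rewrite /fits all_cat all_nseq /= orbT.
have uW0 : all (fun p => uniq p.2) W0 by rewrite all_cat all_nseq /= iota_uniq !orbT.
have lW0 : lasts W0 [::].
  by apply: lasts_uniq; rewrite cats0 flat0 iota_uniq.
pose V := fuse 0 W0 W; pose u0 := undup (flat W).
pose u : seq (nat + nat * T) :=
  map inl (iota 0 t) ++ [seq copy nat i x | i <- iota 0 q, x <- u0].
have su : size u = q * nsym W + t.
  by rewrite size_cat size_map size_allpairs !size_iota addnC.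
have uu : uniq u.
  rewrite cat_uniq map_inj_uniq ?iota_uniq //=; last by move=> x y [].
  apply/andP; split.
    by apply/hasPn => _ /allpairsP[[i x] [_ _ ->]] /=; apply/negP => /mapP[].
  apply: allpairs_uniq; rewrite ?iota_uniq ?undup_uniq //.
  by move=> -[i x] [j y] _ _ [-> ->].
have cu i x : count_mem (copy nat i x) (flat V) =
    if i < q then count_mem x (flat W) else 0.
  rewrite (count_embed (@copyK nat T i) (@copyK' nat T i)) uncopy_fuse nW0 /=.
  by case: ifP.
have co x : count_mem (inl x) (flat V) = count_mem x (iota 0 t).
  rewrite (count_embed (@oldK nat T) (@oldK' nat T)) old_fuse //.
  by rewrite -[symb _ _]/(flat W0) flat0.
have cT x : count_mem x (flat W) = count_mem x (symb id W) + count_mem x (symb negb W).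
  elim: (W) => //= -[p C] Z IH; rewrite !symb_cons flat_cons !count_cat IH.
  by case: p => /=; lia.
rewrite -su; have := @word_lower_bound _ V u s (q * size W).
have -> : \prod_(x <- u) count_mem x (flat V) = (cs + cn) ^ (q * nsym W).
  rewrite big_cat big_map big_allpairs_dep /=.
  rewrite big1_seq ?mul1n => [|x]; last first.
    by rewrite /= => xt; rewrite co count_uniq_mem ?iota_uniq // xt.
  transitivity (\prod_(i <- iota 0 q) (cs + cn) ^ nsym W).
    apply: eq_big_seq => i; rewrite mem_iota /= => iq.
    transitivity (\prod_(x <- u0) (cs + cn)).
      by apply: eq_big_seq => x; rewrite mem_undup cu iq cT => /cW[-> ->].
    by rewrite big_const_seq count_predT iter_muln_1.
  by rewrite big_const_seq count_predT size_iota iter_muln_1 -expnM mulnC.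
apply => //.
- exact: uniq_fuse.
- have nT (X : eqType) (Z : blocks X) : nblocks predT Z = size Z by apply: count_predT.
  rewrite -nT nblocks_fuse nW0 nT /W0 nblocks_cat /nblocks count_nseq /=; lia.
- apply: runs_fuse sl fW0 uW0 _ _ rW => // a b ab.
  by apply: leq_trans (runs_uniq ab _) _; rewrite ?flat0 ?iota_uniq.
- case=> [x|[i x]]; rewrite -has_pred1 has_count.
    rewrite co count_uniq_mem ?iota_uniq // lt0b => xt.
    by rewrite mem_cat map_f.
  rewrite cu; case: ifP => // iq; rewrite -has_count has_pred1 => xW.
  rewrite mem_cat; apply/orP; right; apply/allpairsP; exists (i, x).
  by rewrite mem_iota /= iq mem_undup.
- by rewrite s0 su.
Qed.

(** The coefficient times [2 ^ n] is one term of [(2 + 1) ^ (n + M)], which is at most [4 ^ n]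
    because [3 ^ 5 <= 4 ^ 4]. *)
Lemma bin_le_exp2 n M : 4 * M <= n -> 'C(n + M, M) <= 2 ^ n.
Proof.
move=> Mn; have h : 'C(n + M, M) * 2 ^ n <= 3 ^ (n + M).
  rewrite -[3]/(2 + 1) expnDn (bigD1 (inord M : 'I_(n + M).+1)) //=.
  by rewrite inordK ?ltnS ?leq_addl // exp1n muln1 addnK leq_addr.
have h2 : 3 ^ (n + M) <= 2 ^ n * 2 ^ n.
  rewrite -expnMn -(subnKC Mn); elim: (n - 4 * M) => [|j IH].
    rewrite addn0 -mulSnr expnM [(2 * 2) ^ _]expnM; elim: (M) => // k IHk.
    rewrite !expnS; apply: leq_mul => //.
  by rewrite addnS addSn !expnS; apply: leq_mul.
by rewrite -(leq_pmul2r (expn_gt0 2 n)); apply: leq_trans h h2.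
Qed.

(** * From the inverse Ackermann function to the size of the words *)

Lemma alphad_ack e m n : (alphad e.+1 n <= m) = (n <= ack e m).
Proof.
elim: e m n => [|e IH] m n; first by rewrite alphad_1 /=; lia.
have small k : n <= 1 -> alphad e.+2 n <= k by case: n => [|[]].
elim: m n {small} => [|m IHm] n.
  case: (ltnP 1 n) => n1; last by case: n n1 => [|[]].
  by rewrite alphad_rec //= ltn0 leqNgt n1.
case: (ltnP 1 n) => n1; last first.
  have -> : alphad e.+2 n = 0 by case: n n1 => [|[]].
  by apply/esym/(leq_trans n1)/(leq_trans _ (proj2 (exp2_le_ack e m.+1))).
by rewrite alphad_rec // ltnS IHm IH.
Qed.

Lemma alpha_ack n a : alpha n = a.+2 -> ack a 3 < n.
Proof.
rewrite /alpha; case: ex_minnP => k _ kmin ke; subst k.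
by rewrite ltnNge -alphad_ack; apply/negP => h; have := kmin a.+1 h; rewrite ltnn.
Qed.

Lemma alpha_unbounded C : exists N, forall n, N <= n -> C < alpha n.
Proof.
exists (\sum_(e < C) ack e 3).+1 => n nN.
rewrite /alpha; case: ex_minnP => -[//|k] /=; rewrite alphad_ack => nk _.
rewrite ltnNge; apply/negP => kC.
have := leq_trans nN nk; rewrite (bigD1 (Ordinal kC)) //=; lia.
Qed.

Lemma ack2 e : ack e 2 = 4.
Proof. by elim: e => //= e IH; have -> : ack e 1 = 2 by elim: e {IH} => //= e ->. Qed.

Lemma ack_S4 e : ack e.+1 4 = ack e (ack e 4).
Proof. by transitivity (ack e (ack e (ack e.+1 2))) => //; rewrite ack2. Qed.

Lemma ack4_ge e : e < ack e 4.
Proof.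
elim: e => // e IH; rewrite ack_S4; apply: leq_ltn_trans IH _.
by case: e => // e; case: (exp2_le_ack e (ack e.+1 4)).
Qed.

Lemma ack4_exp K : 2 ^ (2 ^ K.+2) <= ack K.+3 4.
Proof.
have e2 e : 2 ^ ack e.+1 4 <= ack e.+2 4.
  by rewrite [ack e.+2 4]ack_S4; apply: (proj1 (exp2_le_ack e _)).
apply: leq_trans (e2 _); rewrite leq_exp2l //; apply: leq_trans (e2 _).
by rewrite leq_exp2l //; apply: ack4_ge.
Qed.

Lemma ack_twice e y : 4 <= y -> ack e.+1 (ack e.+1 y) <= ack e.+2 y.
Proof.
move=> y4; rewrite -(subnK y4); move: (y - 4) => z {y y4}.
rewrite addn4; have -> : ack e.+2 z.+4 = ack e.+1 (ack e.+1 (ack e.+2 z.+2)) by [].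
do 2 apply: ack_mono; apply: leq_trans (proj1 (exp2_le_ack _ _)).
by elim: z => // z IH; rewrite expnS; lia.
Qed.

(** The shift 7 gives [n > ack (K + 5) 3], which is [ack K.+3 (ack K.+3 4)]. The inner value
    dominates [6 * m + 16]; the outer [ack K.+3] covers two applications of [ack K.+2], one for
    [bound K m] and one for the cube. *)
Lemma main_size K m n : alpha n = K + 7 -> 6 * m + 16 <= ack K.+3 4 ->
  bound K m * m * m <= n.
Proof.
move=> an mK; have := @alpha_ack n (K + 5); rewrite an => /(_ _) /ltnW.
have -> : K + 7 = (K + 5).+2 by lia.
move=> /(_ erefl); apply: leq_trans.
have -> : ack (K + 5) 3 = ack K.+3 (ack K.+3 4).
  have -> : K + 5 = K.+4.+1 by lia.
  by rewrite -ack_S4; transitivity (ack K.+4 (ack K.+4.+1 2)) => //; rewrite ack2.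
set y := 6 * m + 16 in mK *; have y16 : 16 <= y by rewrite leq_addl.
apply: leq_trans (ack_mono _ mK); apply: leq_trans (ack_twice K.+1 _); last by lia.
have b1 : bound K m <= ack K.+2 y := bound_ack K m.
have b2 : m <= ack K.+2 y by apply: leq_trans (leq_ack _ _); rewrite /y; lia.
apply: leq_trans (leq_mul (leq_mul b1 b2) b2) (cube_le_ack _ _).
by apply: leq_trans y16 (leq_ack _ _).
Qed.

(** [m] is four times the number of occurrences of a symbol, so the word has four times as many
    symbols as blocks and [bin_le_exp2] applies. One factor [2 ^ n] pays for the binomial
    coefficient, the other for the leftover symbols. *)
Lemma r_even_lower t K n : 0 < t -> 2 < K -> alpha n = K + 7 -> 2 * t + 2 <= n ->
  2 ^ ('C(K, t) * n) <= 4 ^ n * r (2 * t + 2) n.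
Proof.
move=> t0 K2 an tn; set c := 'C(K, t); pose m := 4 * 2 ^ c.
have cK : c <= 2 ^ K.
  have [tK|tK] := leqP t K; last by rewrite /c bin_small.
  have := expnDn 1 1 K; rewrite addn1 (bigD1 (inord t)) //= => ->.
  by rewrite inordK ?ltnS // !exp1n !muln1 leq_addr.
have mK : 6 * m + 16 <= ack K.+3 4.
  apply: leq_trans (ack4_exp K); have h : 2 ^ c <= 2 ^ 2 ^ K by rewrite leq_exp2l.
  apply: (@leq_trans (2 ^ (6 + 2 ^ K))).
    by rewrite expnD /m; have := expn_gt0 2 (2 ^ K); lia.
  rewrite leq_exp2l // !expnS; have : 2 ^ 2 < 2 ^ K by rewrite ltn_exp2l.
  by lia.
have [T [W [L R0 /andP[S2 Sb]]]] := family_even_holds K m t0.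
have bn := main_size an mK.
set S := nblocks id W in S2 Sb; set l := nsym W.
have lS : l = 4 * S.
  have := nsym_special (m := m) (cs := 2 ^ c) (W := W); case: L => -[bs _ _ cs] _.
  move=> /(_ bs (fun x xW => proj1 (cs x xW))); rewrite -/l -/S /m.
  rewrite mulnA [S * 4]mulnC => /eqP; rewrite eqn_pmul2r ?expn_gt0 // => /eqP //.
have WS : size W = S.
  rewrite -(count_predC fst W) -[count fst W]/S -[count _ W]/(nblocks negb W).
  by rewrite R0 addn0.
have cm : c <= m by rewrite /m; have := ltn_expl c (leqnn 2); lia.
have lm : l <= bound K m * m.
  rewrite lS mulnC; apply: leq_mul => //.
  by rewrite /m; have := expn_gt0 2 c; lia.
have lc : l * c <= n by apply: leq_trans bn; apply: leq_mul.
have l0 : 0 < l by rewrite lS; lia.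
have := @copies_lower_bound T W _ _ _ _ _ (n %/ l) (n %% l) L.
rewrite -/l -divn_eq addn0 WS => /(_ _ tn) H.
have {H} := H ltac:(lia); rewrite -expnM => H.
have qn : 4 * (n %/ l * S) <= n.
  by rewrite mulnCA -lS leq_trunc_div.
have := leq_trans H (leq_mul (leqnn _) (bin_le_exp2 qn)) => {}H.
(* The leftover exponent is at most [l * c], hence at most [n]. *)
have -> : c * n = c * (n %/ l * l) + c * (n %% l) by rewrite {1}(divn_eq n l) mulnDr.
rewrite expnD -[4]/(2 * 2) expnMn -mulnA [2 ^ n * (2 ^ n * _)]mulnC.
rewrite [2 ^ n * r _ _]mulnC.
apply: leq_mul => //; rewrite leq_exp2l //; apply: leq_trans lc.
by rewrite mulnC leq_mul2r (ltnW (ltn_pmod _ l0)) orbT.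
Qed.

(** The first two terms of the binomial expansion both equal [K ^ K]. *)
Lemma bernoulli_double K : 0 < K -> 2 * K ^ K <= K.+1 ^ K.
Proof.
move=> K0; rewrite -[K.+1]addn1 expnDn; case: K K0 => // k _.
rewrite big_ord_recl /= big_ord_recl /= /bump /= bin0 bin1 !exp1n !muln1 mul1n subn0.
by rewrite addn0 subSS subn0 -expnS mul2n -addnn addnA leq_addr.
Qed.

(** Raising the base from [K] to [K.+1] on [K * (K * l)] factors gains at least [2 ^ (K * l)], which
    exceeds [K ^ t]. *)
Lemma expn_succ_absorb K l t N : 0 < K -> t <= l -> K * (K * l) <= N ->
  K ^ (N + t) <= K.+1 ^ N.
Proof.
move=> K0 tl KN; rewrite -(subnKC KN); move: (N - _) => b {N KN}.
have mono x y e : x <= y -> x ^ e <= y ^ e.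
  by move=> xy; elim: e => // e IH; rewrite !expnS leq_mul.
have h1 : 2 ^ (K * l) * K ^ (K * (K * l)) <= K.+1 ^ (K * (K * l)).
  by rewrite [K ^ _]expnM [K.+1 ^ _]expnM -expnMn mono ?bernoulli_double.
have h2 : K ^ t <= 2 ^ (K * l).
  rewrite expnM; apply: leq_trans (leq_pexp2l K0 tl) _.
  exact: mono (ltnW (ltn_expl K _)).
rewrite !expnD mulnAC; apply: leq_mul; last exact: mono.
by apply: leq_trans h1; rewrite mulnC leq_mul2r h2 orbT.
Qed.

(** Nonspecial blocks count too, hence the [m] with [4 * size W <= nsym W]. Symbols occur [K.+1]
    times; the weaker base [K] pays for the leftover, and [2 ^ n] for the binomial coefficient. *)
Lemma r_three_lower K n : 2 < K -> alpha n = K + 7 -> 3 <= n ->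
  K ^ n <= 2 ^ n * r 3 n.
Proof.
move=> K2 an n3; pose m := 4 * (1 + K.+1 ^ 2).
have mK : 6 * m + 16 <= ack K.+3 4.
  apply: leq_trans (ack4_exp K).
  have h : K.+1 ^ 2 <= 2 ^ K.+1.
    rewrite -(subnK K2) -mulnn; elim: (K - 3) => // k IH.
    by rewrite addSn [2 ^ _]expnS; nia.
  apply: (@leq_trans (2 ^ (6 + K.+1))).
    by rewrite expnD /m; lia.
  rewrite leq_exp2l //.
  have h3 : K.+4 <= 2 ^ K.+1.
    by rewrite -(subnK K2); elim: (K - 3) => // k IH; rewrite addSn expnS; lia.
  by rewrite expnS; lia.
have [T [W [L /andP[S2 Sb] R]]] := family3_holds K m.
have bn := main_size an mK.
set S := nblocks id W in S2 Sb R; set l := nsym W.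
have lS : l = S * m.
  have := nsym_special (m := m) (cs := 1) (W := W); case: L => -[bs _ _ cs] _.
  by move=> /(_ bs (fun x xW => proj1 (cs x xW))); rewrite muln1.
have WS : size W <= S * (1 + K.+1 ^ 2).
  rewrite -(count_predC fst W) -[count fst W]/S -[count _ W]/(nblocks negb W); lia.
have lm : l <= bound K m * m by rewrite lS leq_mul2r Sb orbT.
have Km : K ^ 2 + 1 <= m by rewrite /m; nia.
have lc : l * (K ^ 2 + 1) <= n by apply: leq_trans bn; apply: leq_mul.
have l0 : 0 < l by rewrite lS /m; nia.
set q := n %/ l; set t := n %% l; have nE : n = q * l + t := divn_eq n l.
have tl : t < l by rewrite ltn_mod.
have := @copies_lower_bound T W _ _ _ _ _ q t L isT.
rewrite -/l -nE add1n => /(_ n3) H.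
have qn : 4 * (q * size W) <= n.
  apply: leq_trans (leq_trunc_div n l); rewrite -/q mulnCA leq_mul2l; apply/orP; right.
  by rewrite lS /m; lia.
have {qn} H := leq_trans H (leq_mul (leqnn _) (bin_le_exp2 qn)).
rewrite mulnC; apply: leq_trans H.
have qlK : K * (K * l) <= q * l.
  move: lc; rewrite {1}nE; nia.
rewrite {1}nE; apply: (expn_succ_absorb _ (ltnW tl) qlK).
exact: ltnW (ltnW K2).
Qed.

(* Passage to real numbers and asymptotics *)
From mathcomp Require Import all_order all_algebra.
From mathcomp Require Import all_classical all_reals all_analysis.
From mathcomp Require Import ring lra.
Import Order.TTheory GRing.Theory Num.Theory.
Import numFieldNormedType.Exports.

Lemma expn_add_le x d t :
  ((x + d) ^ t <= x ^ t + t * d * (x + d) ^ (t - 1))%N.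
Proof.
elim: t => [|[|t] IH]; first by rewrite !expn0.
  by rewrite !expn1 subnn expn0; lia.
rewrite subSS subn0 in IH *; rewrite expnS mulnDl [X in (_ <= X + _)%N]expnS.
have := leq_mul (leqnn x) IH.
set y := (x + d)%N in IH *; rewrite [(y ^ t.+1)%N]expnS => h.
have : (x * (y ^ t) <= y * y ^ t)%N by rewrite leq_mul2r leq_addr orbT.
nia.
Qed.

Lemma expn_le_ffact x t : (x ^ t <= (x + t) ^_ t)%N.
Proof.
elim: t => // t IH; rewrite addnS ffactSS expnS; apply: leq_mul => //.
by rewrite -addnS leq_addr.
Qed.

(** The falling factorial of [K] is at least [(K - t) ^ t], and [K + c] exceeds [K - t] by
    [t + c]. *)
Lemma bin_lower K t c : (t <= K)%N ->
  ((K + c) ^ t <= t`! * 'C(K, t) + t * (t + c) * (K + c) ^ (t - 1))%N.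
Proof.
move=> tK; have -> : (K + c = (K - t) + (t + c))%N by lia.
apply: leq_trans (expn_add_le _ _ _) _; rewrite leq_add2r mulnC bin_ffact.
by have := expn_le_ffact (K - t) t; rewrite subnK.
Qed.

Local Open Scope classical_set_scope.
Local Open Scope ring_scope.

Lemma bigO_scale (R : realType) (C : R) (g : nat -> R) :
  (fun n => C * g n) =O_\oo g.
Proof.
apply/eqO_exP; exists (`|C| + 1); first exact: ltr_wpDl.
apply: filterE => n; rewrite normrM ler_wpM2r // lerDl //.
Qed.

Theorem theorem1p2 (R : realType) :
  (exists2 e : nat -> R, e =O_\oo (fun _ : nat => 1 : R) &
     \forall n \near \oo,
       ((alpha n)%:R / 2 - e n) ^+ n <= (r 3 n)%:R) /\
  (forall t : nat, (1 <= t)%N ->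
     exists2 e : nat -> R, e =O_\oo (fun n : nat => (alpha n)%:R ^+ (t - 1) : R) &
       \forall n \near \oo,
         (r (2 * t + 2) n <= r (2 * t + 3) n)%N /\
         2 `^ (n%:R * ((t`!)%:R^-1 * (alpha n)%:R ^+ t - e n))
           <= (r (2 * t + 2) n)%:R).
Proof.
split.
  (* Half the shift 7 between [alpha n] and [K]. *)
  exists (fun=> 7%:R / 2 * 1); first exact: bigO_scale.
  have [N aN] := alpha_unbounded 9; exists (maxn N 3) => // n /=.
  rewrite geq_max => /andP[/aN an n3].
  have [K KE] : exists K, alpha n = (K + 7)%N by exists (alpha n - 7)%N; lia.
  have := @r_three_lower K n _ KE n3; rewrite KE => /(_ ltac:(lia)).
  rewrite -(ler_nat R) natrM !natrX => h.
  have -> : (K + 7)%:R / 2 - 7%:R / 2 * 1 = K%:R / 2 :> R.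
    rewrite natrD. by field.
  by rewrite expr_div_n ler_pdivrMr ?exprn_gt0 // mulrC.
(* [t * (t + 7)] is the loss in [bin_lower] for the shift 7, and 2 comes from [4 ^ n]. *)
move=> t t1; pose C := (t * (t + 7) + 2)%N.
exists (fun n => C%:R * (alpha n)%:R ^+ (t - 1)); first exact: bigO_scale.
have [N aN] := alpha_unbounded (t + 9); exists (maxn N (2 * t + 3)) => // n /=.
rewrite geq_max => /andP[/aN an nt]; split.
  have -> : (2 * t + 3 = (2 * t + 2).+1)%N by lia.
  by apply: r_mono; lia.
have [K KE] : exists K, alpha n = (K + 7)%N by exists (alpha n - 7)%N; lia.
have := @r_even_lower t K n t1 _ KE _; move=> /(_ ltac:(lia) ltac:(lia)).
set c := 'C(K, t) => h.
have hc : (alpha n)%:R ^+ t / t`!%:R - C%:R * (alpha n)%:R ^+ (t - 1) <= c%:R - 2 :> R.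
  have := @bin_lower K t 7 ltac:(lia); rewrite -/c -KE; set a := alpha n.
  rewrite -(ler_nat R) natrD !natrM !natrX => ha.
  have f1 : 1 <= t`!%:R :> R by rewrite ler1n fact_gt0.
  have a1 : 1 <= a%:R ^+ (t - 1) :> R by rewrite exprn_ege1 // ler1n; lia.
  rewrite lerBlDr ler_pdivrMr ?(lt_le_trans ltr01) //.
  apply: le_trans ha _.
  rewrite /C (natrD _ (t * (t + 7))) -(natrM _ t).
  set D : R := (t * (t + 7))%:R; set g := a%:R ^+ _ in a1 *.
  have D0 : 0 <= D :> R by apply: ler0n.
  (* The difference splits into products that are nonnegative because the factorial and the power
     [g] are at least 1. *)
  rewrite -subr_ge0.
  rewrite (_ : _ - _ = (t`!%:R - 1) * (D * g) + 2 * t`!%:R * (g - 1)); last by ring.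
  by rewrite addr_ge0 ?mulr_ge0 ?subr_ge0 // (le_trans ler01).
rewrite [X in X - _]mulrC.
apply: (@le_trans _ _ (2 `^ (n%:R * (c%:R - 2)))).
  by rewrite ler_powR ?ler1n // ler_wpM2l.
rewrite mulrBr powRB ?pnatr_eq0 ?implybT //.
rewrite ler_pdivrMr ?powR_gt0 // mulrC -!natrM !powR_mulrn //.
move: h; rewrite -(ler_nat R) natrM !natrX mulnC => /le_trans; apply.
by rewrite mulrC [(n * 2)%N]mulnC exprM -(natrX _ 2 2).
Qed.
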